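(* Let $(\epsilon_k)_{k\ge1}$ be any sequence of positive real numbers tending to zero. The following are equivalent: (a) the series $\sum_{k=1}^\infty\left(D_{\epsilon_{k+1}}f-D_{\epsilon_k}f\right)$ is unconditionally convergent in $L^2(\mathbb{T})$ for all $f\in L^2(\mathbb{T})$; (b) there is a finite constant $C$ such that $\displaystyle\sup_{\ell\in\mathbb{Z}}\sum_{k=1}^\infty\left|\widehat\varphi_{\epsilon_{k+1}}(\ell)-\widehat\varphi_{\epsilon_k}(\ell)\right|\le C$.
   Context: $\mathbb{T}=\{z\in\mathbb{C}:|z|=1\}$. For $\epsilon>0$, $D_\epsilon f(e^{ix})=(\varphi_\epsilon*f)(e^{ix})=\frac1{2\epsilon}\int_{-\epsilon}^{\epsilon}f(e^{i(x-y)})\,dy$, and $\widehat\varphi_\epsilon(\ell)=\frac{\sin(\ell\epsilon)}{\ell\epsilon}$ for $\ell\in\mathbb{Z}$ (equal to $1$ at $\ell=0$). A series $\sum_{k=1}^\infty f_k$ in a Banach space is unconditionally convergent if $\sum_{k=1}^\infty f_{\pi(k)}$ converges in norm for every permutation $\pi$ of $\{1,2,3,\dots\}$. *)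

(* Defs.v *)
From HB Require Import structures.
From mathcomp Require Import all_boot all_order all_algebra complex.
From mathcomp Require Import all_classical all_reals all_analysis.

Set Implicit Arguments.
Unset Strict Implicit.
Unset Printing Implicit Defensive.
Import Order.TTheory GRing.Theory Num.Theory.
Import numFieldNormedType.Exports.
Import ComplexField.Normc.

Local Open Scope classical_set_scope.
Local Open Scope ring_scope.
Local Open Scope complex_scope.

Definition circle (R : realType) : Type := {z : R[i] | normc z == 1}.

Section circle_group.
Context {R : realType}.

Lemma normc_expi (x : R) : normc (cos x +i* sin x) == 1.
Proof. by rewrite /normc cos2Dsin2 sqrtr1. Qed.

(* x |-> e^{ix} *)
Definition expi (x : R) : circle R := exist _ (cos x +i* sin x) (normc_expi x).

Lemma normc_circleM (z w : circle R) : normc (sval z * sval w) == 1.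
Proof.
by case: z w => [z /= /eqP z1] [w /= /eqP w1]; rewrite normcM z1 w1 mulr1.
Qed.

Definition circleM (z w : circle R) : circle R :=
  exist _ (sval z * sval w) (normc_circleM z w).

End circle_group.

(* The sigma-algebra on the circle is the quotient one: A is measurable iff
   {x | e^{ix} \in A} is a Borel set of R. As x |-> e^{ix} is continuous and has
   a Borel section, this is the Borel sigma-algebra of the circle. *)
Section circle_measurable.
Context {R : realType}.

HB.instance Definition _ := SubChoice.on (circle R).
HB.instance Definition _ := isPointed.Build (circle R) (expi 0).

Let measurable_circle : set (set (circle R)) :=
  image_set_system setT (@expi R) (@measurable _ (measurableTypeR R)).

Let sigma_algebra_circle : sigma_algebra setT measurable_circle.
Proof. exact/sigma_algebra_image/sigma_algebra_measurable. Qed.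

Let measurable_circle0 : measurable_circle set0.
Proof. by case: sigma_algebra_circle. Qed.

Let measurable_circleC A : measurable_circle A -> measurable_circle (~` A).
Proof. by case: sigma_algebra_circle => _ + _; rewrite -setTD; exact. Qed.

Let measurable_circle_bigcup (F : (set (circle R))^nat) :
  (forall i, measurable_circle (F i)) -> measurable_circle (\bigcup_i F i).
Proof. by case: sigma_algebra_circle => _ _; exact. Qed.

Fact circle_display : measure_display. Proof. exact. Qed.

HB.instance Definition _ := @isMeasurable.Build circle_display (circle R)
  measurable_circle measurable_circle0 measurable_circleC
  measurable_circle_bigcup.

Lemma measurable_expi :
  measurable_fun [set: measurableTypeR R] (@expi R : measurableTypeR R -> circle R).
Proof. by move=> _ A. Qed.

End circle_measurable.

Section L2_circle.
Context {R : realType}.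

Definition expi_mfun : {mfun measurableTypeR R >-> circle R} :=
  HB.pack (@expi R : measurableTypeR R -> circle R)
    (isMeasurableFun.Build _ _ _ _ _ measurable_expi).

Lemma ltNpipi : - pi < pi :> R.
Proof. by rewrite gtrN// pi_gt0. Qed.

(* normalized arc length dx / (2 pi) *)
Definition arc_measure : {measure set (circle R) -> \bar R} :=
  distribution (uniform_prob ltNpipi) expi_mfun.

Definition measurable_cfun (f : circle R -> R[i]) : Prop :=
  measurable_fun setT (fun z => complex.Re (f z)) /\
  measurable_fun setT (fun z => complex.Im (f z)).

Definition L2norm (f : circle R -> R[i]) : \bar R :=
  'N[arc_measure]_2%:E[EFin \o (normc (R:=R) \o f)].

(* Elements of L^2 are handled through their representatives; all notions below
   are invariant under almost everywhere equality. *)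
Definition in_L2 (f : circle R -> R[i]) : Prop :=
  measurable_cfun f /\ (L2norm f < +oo)%E.

Definition L2_convergent (s : nat -> circle R -> R[i]) : Prop :=
  exists2 g, in_L2 g & L2norm (s n - g) @[n --> \oo] --> 0%E.

Definition L2_unconditionally_convergent (u : nat -> circle R -> R[i]) : Prop :=
  forall p : nat -> nat, bijective p -> L2_convergent (series (u \o p)).

(* For z = e^{ix}, the integrand is f(e^{i(x - y)}) = f(z e^{-iy}). *)
Definition Davg (e : R) (f : circle R -> R[i]) : circle R -> R[i] := fun z =>
  ((2 * e)^-1)%:C *
  ((\int[lebesgue_measure]_(y in `[- e, e])
      complex.Re (f (circleM z (expi (- y))))) +i*
   (\int[lebesgue_measure]_(y in `[- e, e])
      complex.Im (f (circleM z (expi (- y)))))).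

Definition phihat (e : R) (l : int) : R :=
  if l == 0 then 1 else sin (l%:~R * e) / (l%:~R * e).

End L2_circle.

(* Main.v *)
Require Import Defs.
From HB Require Import structures.
From mathcomp Require Import all_boot all_order all_algebra complex.
From mathcomp Require Import all_classical all_reals all_analysis.
From mathcomp Require Import measurable_realfun ring lra.
Set Implicit Arguments.
Unset Strict Implicit.
Unset Printing Implicit Defensive.
Import Order.TTheory GRing.Theory Num.Theory.
Import numFieldNormedType.Exports.
Local Open Scope classical_set_scope.
Local Open Scope ring_scope.

(** Write the operators on the Fourier side. The average over an arc of half
length e is a convolution, so it multiplies the Fourier coefficient of index l
by phihat e l, and the k-th term of the series acts as the multiplier
delta k l = phihat (eps k.+1) l - phihat (eps k) l.

Sufficiency of the bound. Let p be a permutation of the indices. For a fixed l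
the scalar series of the delta k l is absolutely convergent, hence its
rearrangement along p has partial sums bounded by C and the same sum as the
original series, which telescopes to 1 - phihat (eps 0) l because phihat (eps k) l
tends to 1. So the partial sums of the rearranged series, minus the candidate
limit f - D_(eps 0) f, are multipliers that are bounded uniformly in l and tend
to 0 for each l. Parseval and dominated convergence over l give convergence to 0
in L2 ([multiplier_cvg0], [davgs_perm_cvg]).

Necessity of the bound is a gliding hump. If the sums over k of |delta k l| are
not bounded uniformly in l, then neither are their tails, so the indices can be
cut into consecutive blocks, the j-th of which carries, at some frequency n_j, a
variation at least 2 * 4 ^ j. Inside the block the terms of one sign carry half
of it. For the permutation that puts these terms first in each block, and for
f = sum_j 4 ^ - j cos (n_j x), the coefficient of index n_j of a stretch of the
rearranged series stays bounded below ([coef_cosine_series_ge]); by Bessel the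
partial sums are not Cauchy.

Parseval enters as an inequality: the energy of h is at most the sum of the
energies of its harmonics ([parseval]). For Lipschitz h it follows from
pointwise convergence of the Fourier series (dividing h - h x by the denominator
of the Dirichlet kernel leaves a bounded function, to which the Riemann-Lebesgue
lemma applies) and from the lemma of Fatou. The averaging operators themselves do the
rest: averages of square integrable functions are bounded, averages of bounded
functions are Lipschitz, averaging does not increase the energy of any harmonic,
and averages over shrinking intervals converge almost everywhere by the Lebesgue
differentiation theorem. Two applications of Fatou transfer the inequality from
Lipschitz to bounded and then to arbitrary functions.

All of this is done for real functions of period 2 pi on the line, with the
system cos (n x), sin (n x): the averages act separately on the real and
imaginary parts of a function on the circle, and phihat is even in l. *)

(** * Reflections, shifts and periods of the Lebesgue integral *)

Section reflection.
Context {R : realType}.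
Local Notation mu := (@lebesgue_measure R).

Definition reflect_at (c : R) : measurableTypeR R -> measurableTypeR R :=
  fun x => c - x.

Lemma measurable_reflect_at c : measurable_fun setT (reflect_at c).
Proof. by apply: measurable_funB. Qed.

HB.instance Definition _ c :=
  isMeasurableFun.Build _ _ _ _ (reflect_at c) (measurable_reflect_at c).

Lemma preimage_reflect_itv (c : R) (a b : R) (i j : bool) :
  reflect_at c @^-1` [set` Interval (BSide i a) (BSide j b)] =
  [set` Interval (BSide (~~ j) (c - b)) (BSide (~~ i) (c - a))].
Proof.
apply/seteqP; split => x /=; rewrite !in_itv/= /reflect_at;
 case: i; case: j => /=; lra.
Qed.

(** Reflections generate the isometries of the line, so this single invariance
yields both the change of variable y |-> x - y in the averages and the
translations. *)
Lemma lebesgue_measure_reflect (c : R) A : measurable A ->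
  pushforward mu (reflect_at c) A = mu A.
Proof.
move=> mA; apply/esym/lebesgue_measure_unique => //= _ [[a b]] _ <-.
rewrite /pushforward preimage_reflect_itv/= !lebesgue_measure_itv/= !lte_fin.
by rewrite ltrD2l ltrN2 -!EFinB; congr (if _ then _%:E else _); ring.
Qed.

Lemma eq_integral_itv (f : R -> \bar R) (a b a' b' : R) : a = a' -> b = b' ->
  (\int[mu]_(x in `[a, b]) f x = \int[mu]_(x in `[a', b']) f x)%E.
Proof. by move=> -> ->. Qed.

Lemma ge0_integral_reflect (f : R -> \bar R) (a b c : R) :
  measurable_fun setT f -> (forall x, 0 <= f x)%E ->
  (\int[mu]_(x in `[a, b]) f (c - x)%R =
   \int[mu]_(x in `[(c - b)%R, (c - a)%R]) f x)%E.
Proof.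
move=> mf f0.
transitivity (\int[pushforward mu (reflect_at c)]_(x in `[(c - b)%R, (c - a)%R]) f
  x)%E; last first.
  by apply: eq_measure_integral => //= A mA AS; exact: lebesgue_measure_reflect.
rewrite ge0_integral_pushforward//=; last exact: measurable_funTS.
by rewrite preimage_reflect_itv /= !subKr.
Qed.

Lemma integral_reflect (f : R -> \bar R) (a b c : R) :
  measurable_fun setT f ->
  (\int[mu]_(x in `[a, b]) f (c - x)%R =
   \int[mu]_(x in `[(c - b)%R, (c - a)%R]) f x)%E.
Proof.
move=> mf; rewrite integralE [RHS]integralE.
under eq_integral do rewrite (funepos_comp f (fun x : R => c - x)).
under [X in (_ - X)%E]eq_integral do rewrite (funeneg_comp f (fun x : R => c - x)).
congr (_ - _)%E.
  exact: (ge0_integral_reflect a b c (measurable_funepos mf) (funepos_ge0 f)).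
exact: (ge0_integral_reflect a b c (measurable_funeneg mf) (funeneg_ge0 f)).
Qed.

(** A translation is the composition of two reflections. *)
Lemma integral_shift (f : R -> \bar R) (a b c : R) :
  measurable_fun setT f ->
  (\int[mu]_(x in `[a, b]) f (x + c)%R =
   \int[mu]_(x in `[(a + c)%R, (b + c)%R]) f x)%E.
Proof.
move=> mf.
have -> : (\int[mu]_(x in `[a, b]) f (x + c)%R =
   \int[mu]_(x in `[a, b]) (fun y : R => f (c - y)%R) (0 - x)%R)%E.
  by apply: eq_integral => x _; congr f; ring.
rewrite (@integral_reflect (fun y : R => f (c - y)%R) a b 0%R); last first.
  exact: (measurableT_comp mf (measurable_reflect_at c)).
by rewrite (@integral_reflect f _ _ c)//; apply: eq_integral_itv; ring.
Qed.

End reflection.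

Section periodic_integral.
Context {R : realType}.
Local Notation mu := (@lebesgue_measure R).
Local Notation I := `[- pi, (pi : R)]%classic.

Lemma ge0_integral_itv_split (f : R -> \bar R) (a c b : R) :
  measurable_fun setT f -> (forall x, 0 <= f x)%E -> a <= c <= b ->
  (\int[mu]_(x in `[a, b]) f x =
   \int[mu]_(x in `[a, c]) f x + \int[mu]_(x in `[c, b]) f x)%E.
Proof.
move=> mf f0 /andP[ac cb].
rewrite (@itv_bndbnd_setU _ _ _ (BRight c)) ?bnd_simp//.
rewrite ge0_integral_setU//=; last 2 first.
  exact: measurable_funTS.
  apply/disj_setPS => y [/=]; rewrite 2!in_itv/=; lra.
by rewrite integral_itv_obnd_cbnd//; exact: measurable_funTS.
Qed.

Definition periodic2pi (U : Type) (f : R -> U) :=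
  forall x, f (x + pi *+ 2) = f x.

Lemma periodicz (U : Type) (f : R -> U) : periodic2pi f ->
  forall (k : int) x, f (x + k%:~R * (pi *+ 2)) = f x.
Proof.
move=> pf; have pn (n : nat) x : f (x + n%:R * (pi *+ 2)) = f x.
  elim: n => [|n <-]; first by rewrite mul0r addr0.
  by rewrite -[in RHS]pf -(natr1 n); congr f; ring.
case=> [n|n] x; first by rewrite -pmulrn pn.
by rewrite NegzE mulrNz mulNr -[in RHS](subrK (n.+1%:R * (pi *+ 2)) x) pn -pmulrn.
Qed.

(** After a translation by a multiple of the period, c lies in the period
centred at 0; then the part of the window that sticks out on the right is the
translate of the part that is missing on the left. *)
Lemma ge0_integral_periodic (f : R -> \bar R) (c : R) :
  measurable_fun setT f -> (forall x, 0 <= f x)%E -> periodic2pi f ->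
  (\int[mu]_(x in `[c, (c + pi *+ 2)%R]) f x = \int[mu]_(x in I) f x)%E.
Proof.
move=> mf f0 pf; have pi0 := pi_gt0 R;
  have p20 : 0 < (pi : R) *+ 2 by rewrite pmulrn_rgt0.
wlog : c / - pi <= c <= pi => [wl|/andP[c1 c2]].
  pose k := Num.floor ((c + pi) / (pi *+ 2)).
  have := floor_itv ((c + pi) / (pi *+ 2)).
  rewrite -/k ler_pdivlMr // ltr_pdivrMr // => /andP[k1 k2].
  pose c' := c - k%:~R * (pi *+ 2).
  transitivity (\int[mu]_(x in `[c', (c' + pi *+ 2)%R]) f (x + k%:~R * (pi *+ 2))%R)%E.
    by rewrite integral_shift//; apply: eq_integral_itv; rewrite /c'; ring.
  under eq_integral do rewrite periodicz//.
  apply: wl; move: k1 k2; rewrite intrD mulrDl /c' mul1r.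
  move: (_ * _) => z; lra.
rewrite (@ge0_integral_itv_split _ _ pi)//; last lra.
rewrite [RHS](@ge0_integral_itv_split _ _ c)//; last lra.
rewrite addeC; congr (_ + _)%E.
have /esym := @integral_shift _ f (- pi) c (pi *+ 2) mf.
under [in X in _ = X]eq_integral do rewrite pf.
have -> // : - pi + pi *+ 2 = pi :> R by ring.
Qed.

Lemma integral_periodic (f : R -> \bar R) (c : R) :
  measurable_fun setT f -> periodic2pi f ->
  (\int[mu]_(x in `[c, (c + pi *+ 2)%R]) f x = \int[mu]_(x in I) f x)%E.
Proof.
move=> mf pf; rewrite integralE [RHS]integralE.
rewrite -!(@ge0_integral_periodic _ c)//.
- exact: measurable_funeneg.
- by move=> x; rewrite /= !funenegE pf.
- exact: measurable_funepos.
- by move=> x; rewrite /= !funeposE pf.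
Qed.

Lemma integral_periodic_shift (f : R -> \bar R) (c : R) :
  measurable_fun setT f -> periodic2pi f ->
  (\int[mu]_(x in I) f (x + c)%R = \int[mu]_(x in I) f x)%E.
Proof.
move=> mf pf; rewrite integral_shift// -(@integral_periodic _ (- pi + c))//.
by apply: eq_integral_itv; ring.
Qed.

Lemma ge0_integral_periodic_muln (f : R -> \bar R) (n : nat) :
  measurable_fun setT f -> (forall x, 0 <= f x)%E -> periodic2pi f ->
  (\int[mu]_(x in `[0%R, (n%:R * (pi *+ 2))%R]) f x =
   n%:R%:E * \int[mu]_(x in I) f x)%E.
Proof.
move=> mf f0 pf; have pi0 := pi_gt0 R;
  have p20 : 0 < (pi : R) *+ 2 by rewrite pmulrn_rgt0.
elim: n => [|n IH]; first by rewrite mul0r set_itv1 integral_set1 mul0e.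
rewrite (@ge0_integral_itv_split _ _ (n%:R * (pi *+ 2)))//; last first.
  by rewrite (mulr_ge0 (ler0n _ _) (ltW p20))/= ler_pM2r// ler_nat.
rewrite IH -(natr1 n) EFinD ge0_muleDl ?lee_fin// mul1e; congr (_ + _)%E.
rewrite -(@integral_periodic _ (n%:R * (pi *+ 2)))//.
by apply: eq_integral_itv; ring.
Qed.

Lemma periodic_integrable_itv (f : R -> R) a b :
  measurable_fun setT f -> periodic2pi f ->
  mu.-integrable I (EFin \o f) -> mu.-integrable `[a, b] (EFin \o f).
Proof.
move=> mf pf /integrableP[_ ifoo]; have pi0 := pi_gt0 R;
  have p20 : 0 < (pi : R) *+ 2 by rewrite pmulrn_rgt0.
apply/integrableP; split; first exact/measurable_EFinP/measurable_funTS.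
pose g x := `|(f x)%:E|%E.
have mg : measurable_fun setT g by apply: measurableT_comp => //;
  exact/measurable_EFinP.
have pg : periodic2pi g by move=> x; rewrite /g pf.
(* the n periods that start at the k-th multiple of the period cover the interval *)
pose k := Num.floor (a / (pi *+ 2)).
have := floor_itv (a / (pi *+ 2)).
rewrite -/k ler_pdivlMr // ltr_pdivrMr // => /andP[k1 k2].
have := ltW (truncnS_gt ((b - k%:~R * (pi *+ 2)) / (pi *+ 2))).
set n := (Num.truncn _).+1.
rewrite ler_pdivrMr // => bn.
apply: (@le_lt_trans _ _
  (\int[mu]_(x in `[(0 + k%:~R * (pi *+ 2))%R,
    (n%:R * (pi *+ 2) + k%:~R * (pi *+ 2))%R]) g x)%E).
  apply: ge0_subset_integral => //=; first exact: measurable_funTS.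
  by move=> x /=; rewrite !in_itv/= add0r; lra.
rewrite -integral_shift//; under eq_integral do rewrite periodicz//.
have g0 x : (0 <= g x)%E by exact: abse_ge0.
rewrite ge0_integral_periodic_muln//.
have : (\int[mu]_(x in I) g x)%E \is a fin_num.
  by rewrite ge0_fin_numE; [exact: ifoo|exact: integral_ge0].
by move=> /fineK <-; rewrite -EFinM ltry.
Qed.

End periodic_integral.

(** * Square integrable functions on a period and the trigonometric system *)

Section square_integrable.
Context {R : realType}.
Local Notation mu := (@lebesgue_measure R).
Local Notation I := `[- pi, (pi : R)]%classic.
Implicit Types h k : R -> R.

Definition sqint h :=
  measurable_fun setT h /\ mu.-integrable I (EFin \o (fun x => h x ^+ 2)).

(** The unnormalised real inner product of L2 over one period. *)
Definition ip h k : R := \int[mu]_(x in I) (h x * k x).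

Let mI : measurable (I : set (measurableTypeR R)). Proof. exact: measurable_itv. Qed.

Lemma integrable_cst_itv (a b c : R) : mu.-integrable `[a, b] (EFin \o cst c).
Proof.
apply: continuous_compact_integrable; first exact: segment_compact.
by apply: continuous_subspaceT => x; exact: cvg_cst.
Qed.

Lemma integrable_bounded_itv (a b M : R) h : measurable_fun setT h ->
  (forall x, `[a, b]%classic x -> `|h x| <= M) ->
  mu.-integrable `[a, b] (EFin \o h).
Proof.
move=> mh hM; apply: le_integrable (integrable_cst_itv a b M) => //.
  exact/measurable_EFinP/measurable_funTS.
by move=> x Ix /=; rewrite lee_fin (le_trans (hM x Ix))// ler_norm.
Qed.

Lemma sqint_bounded (M : R) h : measurable_fun setT h ->
  (forall x, I x -> `|h x| <= M) -> sqint h.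
Proof.
move=> mh hM; split=> //; apply: (@integrable_bounded_itv _ _ (M ^+ 2)).
  exact: measurable_funX.
move=> x Ix; rewrite normrX; have := hM x Ix; have := normr_ge0 (h x).
by move=> h0 hMx; rewrite ler_sqr ?nnegrE// (le_trans h0).
Qed.

Lemma integrable_ip h k : sqint h -> sqint k ->
  mu.-integrable I (EFin \o (fun x => h x * k x)).
Proof.
move=> [mh ih] [mk ik]; have := integrableD mI ih ik.
apply: le_integrable => //.
  exact/measurable_EFinP/measurable_funTS/measurable_funM.
move=> x Ix /=; rewrite !lee_fin normrM.
rewrite [leRHS]ger0_norm ?addr_ge0 ?sqr_ge0//.
rewrite -(real_normK (num_real (h x))) -(real_normK (num_real (k x))).
have := sqr_ge0 (`|h x| - `|k x|); have := normr_ge0 (h x).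
have := normr_ge0 (k x); nra.
Qed.

Lemma sqint_cst c : sqint (cst c).
Proof. by apply: (@sqint_bounded `|c|) => //; exact: measurable_cst. Qed.

Lemma integrable_sqint h : sqint h -> mu.-integrable I (EFin \o h).
Proof.
move=> /integrable_ip /(_ (sqint_cst 1)) /=.
by congr (integrable _ _ _); apply/funext => x /=; rewrite mulr1.
Qed.

Lemma sqintZ c h : sqint h -> sqint (fun x => c * h x).
Proof.
move=> [mh ih]; split; first by apply: measurable_funM.
have := integrableZl mI (c ^+ 2) ih.
by congr (integrable _ _ _); apply/funext => x /=; rewrite exprMn EFinM.
Qed.

Lemma sqintD h k : sqint h -> sqint k -> sqint (fun x => h x + k x).
Proof.
move=> sh sk; split.
  by apply: measurable_funD; [case: sh|case: sk].
have := integrableD mI (integrableD mI sh.2 (integrable_ip sh (sqintZ 2 sk))) sk.2.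
congr (integrable _ _ _); apply/funext => x /=.
by rewrite -!EFinD; congr EFin; ring.
Qed.

Lemma sqintB h k : sqint h -> sqint k -> sqint (fun x => h x - k x).
Proof.
move=> sh sk; have := sqintD sh (sqintZ (-1) sk).
by congr sqint; apply/funext => x; rewrite mulN1r.
Qed.

Lemma sqint_sum (J : Type) (s : seq J) (F : J -> R -> R) :
  (forall j, sqint (F j)) -> sqint (fun x => \sum_(j <- s) F j x).
Proof.
move=> sF; elim: s => [|j s IH].
  by have := sqint_cst 0; congr sqint; apply/funext => x; rewrite big_nil.
have := sqintD (sF j) IH; congr sqint; apply/funext => x.
by rewrite big_cons.
Qed.

Lemma ipC h k : ip h k = ip k h.
Proof. by apply: eq_Rintegral => x _; rewrite mulrC. Qed.

Lemma ipDl h h' k : sqint h -> sqint h' -> sqint k ->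
  ip (fun x => h x + h' x) k = ip h k + ip h' k.
Proof.
move=> sh sh' sk; rewrite /ip; under eq_Rintegral do rewrite mulrDl.
by rewrite RintegralD//; exact: integrable_ip.
Qed.

Lemma ipZl c h k : sqint h -> sqint k ->
  ip (fun x => c * h x) k = c * ip h k.
Proof.
move=> sh sk; rewrite /ip; under eq_Rintegral do rewrite -mulrA.
by rewrite RintegralZl//; exact: integrable_ip.
Qed.

Lemma ipBl h h' k : sqint h -> sqint h' -> sqint k ->
  ip (fun x => h x - h' x) k = ip h k - ip h' k.
Proof.
move=> sh sh' sk; rewrite /ip; under eq_Rintegral do rewrite mulrBl.
by rewrite RintegralB//; exact: integrable_ip.
Qed.

Lemma ip_suml (J : Type) (s : seq J) (F : J -> R -> R) k :
  (forall j, sqint (F j)) -> sqint k ->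
  ip (fun x => \sum_(j <- s) F j x) k = \sum_(j <- s) ip (F j) k.
Proof.
move=> sF sk; elim: s => [|j s IH].
  rewrite big_nil /ip; under eq_Rintegral do rewrite big_nil mul0r.
  by rewrite Rintegral_cst// mul0r.
rewrite big_cons -IH -ipDl//; last exact: sqint_sum.
by rewrite /ip; apply: eq_Rintegral => x _; rewrite big_cons.
Qed.

Lemma ip_ge0 h : 0 <= ip h h.
Proof. by apply: Rintegral_ge0 => x _; rewrite -expr2 sqr_ge0. Qed.

Lemma integral_sqr h : sqint h ->
  (\int[mu]_(x in I) (h x ^+ 2)%:E)%E = (ip h h)%:E.
Proof.
move=> [mh ih]; rewrite /ip /Rintegral; under [in RHS]eq_integral do rewrite -expr2.
by rewrite fineK//; exact: integrable_fin_num.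
Qed.

End square_integrable.

Section trigonometric_system.
Context {R : realType}.
Local Notation mu := (@lebesgue_measure R).
Local Notation I := `[- pi, (pi : R)]%classic.
Implicit Types h k : R -> R.

Lemma continuous_cos_affine (k t : R) : continuous (fun x => cos (k * x + t)).
Proof.
move=> x; apply: (@continuous_comp _ _ _ (fun x => k * x + t) cos);
  last exact: continuous_cos.
by apply: cvgD; [apply: cvgM; [exact: cvg_cst|exact: cvg_id]|exact: cvg_cst].
Qed.

Lemma integral_cos_affine (k t a b : R) : k != 0 -> a < b ->
  \int[mu]_(x in `[a, b]) cos (k * x + t) =
  (sin (k * b + t) - sin (k * a + t)) / k.
Proof.
move=> k0 ab.
pose F x := sin (k * x + t) / k.
have dF (x : R) : is_derive x (1 : R) F (cos (k * x + t)).
  have d1 : is_derive x (1 : R) ((k \*: (id : R -> R)) + cst t : R -> R) (k *: 1 + 0).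
    exact: is_deriveD.
  have := is_derive1_comp (is_derive_sin (((k \*: (id : R -> R)) + cst t : R -> R) x))
    d1.
  move=> /(is_deriveZ k^-1) d2.
  have -> : F = k^-1 \*: (sin \o ((k \*: (id : R -> R)) + cst t : R -> R)).
    by apply/funext => y; rewrite /F mulrC.
  by apply: is_derive_eq d2 _; rewrite addr0 /GRing.scale /= mulr1 mulrCA mulVf ?mulr1.
have cF : continuous F.
  by move=> x; apply/differentiable_continuous/derivable1_diffP; case: (dF x).
rewrite /Rintegral (@continuous_FTC2 _ _ F)//=.
- by rewrite /F -mulrBl.
- by apply: continuous_subspaceT; exact: continuous_cos_affine.
- split.
  + by move=> x _; case: (dF x).
  + by apply: cvg_at_right_filter; exact: cF.
  + by apply: cvg_at_left_filter; exact: cF.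
- by move=> x _; rewrite derive1E; case: (dF x).
Qed.

Lemma sin_natpi (n : nat) : sin (n%:R * pi) = 0 :> R.
Proof.
elim: n => [|n IH]; first by rewrite mul0r sin0.
by rewrite -natr1 mulrDl mul1r sinDpi IH oppr0.
Qed.

Lemma integral_cos_period (k t : R) : sin (k * pi) = 0 ->
  \int[mu]_(x in I) cos (k * x + t) = if k == 0 then pi *+ 2 * cos t else 0.
Proof.
move=> sk; case: eqP => [->|/eqP k0].
  under eq_Rintegral do rewrite mul0r add0r.
  rewrite Rintegral_cst//= lebesgue_measure_itv/= lte_fin ltNpipi/=.
  by rewrite opprK mulrC mulr2n.
rewrite integral_cos_affine ?ltNpipi// mulrN !sinD sinN cosN sk.
by rewrite oppr0 !mul0r subrr mul0r.
Qed.

(** Writing the sine as a shifted cosine lets one product formula cover all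
four kinds of products of waves. *)
Definition phase (b : bool) : R := if b then - (pi / 2) else 0.

Definition wave (b : bool) (n : nat) (x : R) : R := cos (n%:R * x + phase b).

(** The inverse of the squared norm of the waves of frequency n. *)
Definition wgt (n : nat) : R := if n == 0%N then (pi *+ 2)^-1 else pi^-1.

Lemma wgt_gt0 n : 0 < wgt n.
Proof.
have pi0 := pi_gt0 R; rewrite /wgt; case: ifP => _; rewrite invr_gt0 //.
by rewrite pmulrn_rgt0.
Qed.

Lemma wave_cos n x : wave false n x = cos (n%:R * x).
Proof. by rewrite /wave addr0. Qed.

Lemma wave_sin n x : wave true n x = sin (n%:R * x).
Proof. by rewrite /wave cosBpihalf. Qed.

Lemma measurable_wave b n : measurable_fun setT (wave b n).
Proof. apply: continuous_measurable_fun; exact: continuous_cos_affine. Qed.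

Lemma sqint_wave b n : sqint (wave b n).
Proof.
apply: (@sqint_bounded _ 1); first exact: measurable_wave.
by move=> x _; exact: cos_max.
Qed.

(** The exceptional case on the right is the wave true 0, which is the zero
function. *)
Lemma wave_orthonormal b n b' m :
  wgt n * ip (wave b n) (wave b' m) =
  ((n == m) && (b == b') && ((n != 0%N) || ~~ b))%:R.
Proof.
have E x : wave b n x * wave b' m x =
    2^-1 * (cos ((n%:R - m%:R) * x + (phase b - phase b')) +
            cos ((n%:R + m%:R) * x + (phase b + phase b'))).
  rewrite /wave.
  have -> : (n%:R - m%:R) * x + (phase b - phase b') =
     (n%:R * x + phase b) - (m%:R * x + phase b') by ring.
  have -> : (n%:R + m%:R) * x + (phase b + phase b') =
     (n%:R * x + phase b) + (m%:R * x + phase b') by ring.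
  by move: (n%:R * x + _) (m%:R * x + _) => A B; rewrite cosB cosD; field.
have iC (k t : R) : mu.-integrable I (EFin \o (fun x : R => cos (k * x + t))).
  apply: (@integrable_bounded_itv _ _ _ 1) => [|x _]; last exact: cos_max.
  apply: continuous_measurable_fun; exact: continuous_cos_affine.
rewrite /ip; under eq_Rintegral do rewrite E.
rewrite RintegralZl//; last first.
  have mI : measurable (I : set (measurableTypeR R)) by exact: measurable_itv.
  exact: (integrableD mI (iC (n%:R - m%:R) (phase b - phase b'))
                         (iC (n%:R + m%:R) (phase b + phase b'))).
rewrite RintegralD//.
rewrite (@integral_cos_period (n%:R - m%:R)); last first.
  by rewrite mulrBl sinB !sin_natpi mul0r mulr0 subr0.
rewrite (@integral_cos_period (n%:R + m%:R)); last first.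
  by rewrite mulrDl sinD !sin_natpi mul0r mulr0 addr0.
have pi0 := pi_gt0 R.
have cpb : cos (phase b - phase b') = (b == b')%:R.
  by rewrite /phase; case: b {E}; case: b'; rewrite ?subrr ?cos0// ?sub0r ?subr0 ?opprK
    ?cosN ?cos_pihalf.
rewrite subr_eq0 eqr_nat cpb -natrD pnatr_eq0 addn_eq0.
rewrite /wgt; have [<-{m E}|nm] /= := eqVneq n m; last first.
  have [n0|n0] /= := eqVneq n 0%N; last by rewrite addr0 !mulr0.
  by have [m0|m0] := eqVneq m 0%N; [rewrite n0 m0 eqxx in nm|rewrite addr0 !mulr0].
rewrite andbb; have [n0|n0] /= := eqVneq n 0%N; last first.
  by rewrite addr0 mulr_natr andbT; case: (b == b') => /=; field; lra.
have -> : cos (phase b + phase b') = (-1) ^+ (b && b') * (b == b')%:R.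
  rewrite /phase; case: b {cpb}; case: b' => /=;
    rewrite ?addr0 ?add0r ?cosN ?cos_pihalf ?cos0 ?mulr0 ?mulr1 ?expr0//.
  by rewrite -opprD -splitr cosN cospi expr1.
case: b {cpb}; case: b' => /=; rewrite ?mulr0 ?addr0 ?mulr0//.
  by rewrite expr1; ring.
by rewrite expr0; field; lra.
Qed.

Definition coef h (b : bool) (n : nat) : R := ip h (wave b n).

(** The squared norm of the projection of h on the frequency n. *)
Definition energy h (n : nat) : R :=
  wgt n * (coef h false n ^+ 2 + coef h true n ^+ 2).

Definition fsum h (N : nat) (x : R) : R :=
  \sum_(n <- iota 0 N)
    wgt n * (coef h false n * wave false n x + coef h true n * wave true n x).

Lemma energy_ge0 h n : 0 <= energy h n.
Proof. by rewrite mulr_ge0 ?addr_ge0 ?sqr_ge0// ltW// wgt_gt0. Qed.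

Let sqint_fterm h n : sqint (fun x =>
    wgt n * (coef h false n * wave false n x + coef h true n * wave true n x)).
Proof.
by apply/sqintZ/sqintD; apply/sqintZ/sqint_wave.
Qed.

Lemma sqint_fsum h N : sqint (fsum h N).
Proof. by apply: sqint_sum => n; exact: sqint_fterm. Qed.

Lemma ip_fsum h N k : sqint k ->
  ip (fsum h N) k = \sum_(n <- iota 0 N)
    wgt n * (coef h false n * coef k false n + coef h true n * coef k true n).
Proof.
move=> sk; rewrite ip_suml//; apply: eq_bigr => n _.
have sw b : sqint (fun x => coef h b n * wave b n x) by exact/sqintZ/sqint_wave.
rewrite ipZl//; last exact: sqintD.
by rewrite ipDl// !ipZl//; [rewrite ![ip (wave _ _) k]ipC|exact: sqint_wave..].
Qed.

Lemma coef_fsum h N b m : (m < N)%N -> coef (fsum h N) b m = coef h b m.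
Proof.
move=> mN; rewrite /coef ip_fsum; last exact: sqint_wave.
have E n : wgt n * (coef h false n * coef (wave b m) false n +
                    coef h true n * coef (wave b m) true n) =
    if n == m then coef h b m else 0.
  rewrite /coef ![ip (wave b m) _]ipC.
  transitivity (ip h (wave false n) * (wgt n * ip (wave false n) (wave b m)) +
                ip h (wave true n) * (wgt n * ip (wave true n) (wave b m))).
    by ring.
  rewrite !wave_orthonormal orbT andbT.
  have [->|] /= := eqVneq n m; last by rewrite !mulr0 addr0.
  case: b; rewrite /= ?mulr0 ?add0r ?addr0 ?mulr1// orbF.
  case: eqP => [->|] /=; last by rewrite mulr1.
  rewrite mulr0 /ip; under eq_Rintegral do rewrite wave_sin mul0r sin0 mulr0.
  by rewrite Rintegral_cst// mul0r.
rewrite (eq_bigr _ (fun n _ => E n)) (bigD1_seq m) ?iota_uniq ?mem_iota//= eqxx.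
by rewrite big1 ?addr0// => n /negbTE ->.
Qed.

Lemma ip_fsum_self h N : ip (fsum h N) (fsum h N) = \sum_(n <- iota 0 N) energy h n.
Proof.
rewrite ip_fsum; last exact: sqint_fsum.
rewrite big_seq [RHS]big_seq; apply: eq_bigr => n;
  rewrite mem_iota add0n => /andP[_ nN].
by rewrite !coef_fsum// /energy !expr2.
Qed.

Lemma bessel h N : sqint h -> \sum_(n <- iota 0 N) energy h n <= ip h h.
Proof.
move=> sh; have sS := sqint_fsum h N.
have := ip_ge0 (fun x => h x - fsum h N x).
have sD := sqintB sh sS.
rewrite ipBl// (ipC h) (ipC (fsum h N)) !ipBl// ip_fsum_self (ipC h) ip_fsum//.
rewrite (_ : \sum_(n <- _) _ = \sum_(n <- iota 0 N) energy h n); first lra.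
by apply: eq_bigr => n _; rewrite /energy !expr2.
Qed.

(** A single coefficient is controlled by the norm, uniformly in the frequency;
this is how convergence in L2 is contradicted in the necessity part. *)
Lemma coef_sq_le h b n : sqint h -> coef h b n ^+ 2 <= pi *+ 2 * ip h h.
Proof.
move=> sh; have pi0 := pi_gt0 R; have p20 : 0 < (pi : R) *+ 2 by rewrite pmulrn_rgt0.
have := bessel n.+1 sh.
rewrite -addn1 iotaD big_cat/= big_seq1 add0n.
have : 0 <= \sum_(i <- iota 0 n) energy h i by apply: sumr_ge0 => i _;
  exact: energy_ge0.
move=> s0 sb; have {s0 sb} : energy h n <= ip h h by lra.
have w2 : (pi *+ 2)^-1 <= wgt n.
  rewrite /wgt; case: ifP => // _; rewrite lef_pV2 ?posrE//.
  by rewrite mulr2n lerDl ltW.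
have c2 : coef h b n ^+ 2 <= coef h false n ^+ 2 + coef h true n ^+ 2.
  by case: b; rewrite ?lerDl ?lerDr sqr_ge0.
move=> eh; rewrite mulrC -ler_pdivrMr//; apply: le_trans eh.
by rewrite /energy mulrC ler_pM// ?sqr_ge0// invr_ge0 ltW.
Qed.

End trigonometric_system.

(** * Pointwise convergence of Fourier series of Lipschitz functions *)

Section pointwise_convergence.
Context {R : realType}.
Local Notation mu := (@lebesgue_measure R).
Local Notation I := `[- pi, (pi : R)]%classic.
Implicit Types h k : R -> R.

(** Write x^-1 = x * (x ^ 2) ^ -1 and use that real powers are measurable. *)
Lemma measurable_invr : measurable_fun setT (@GRing.inv R).
Proof.
rewrite (_ : GRing.inv = fun x : R => x * (x ^+ 2) `^ (-1)).
  apply: measurable_funM => //.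
  apply: (measurableT_comp (measurable_powR _)).
  exact: measurable_funX.
apply/funext => x; rewrite powR_inv1 ?sqr_ge0//.
have [->|x0] := eqVneq x 0; first by rewrite invr0 mul0r.
by rewrite expr2 invfM mulVKf.
Qed.

Lemma cos_piquarter_ge : 1 / 2 <= cos (pi / 4 : R).
Proof.
have pi0 := pi_gt0 R.
have c0 : 0 <= cos (pi / 4 : R) by apply: cos_ge0_pihalf; lra.
have := cos_mulr2n (pi / 4 : R).
rewrite (_ : pi / 4 *+ 2 = pi / 2); last by field.
rewrite cos_pihalf => c2; rewrite leNgt; apply/negP => c1.
move: c2; rewrite mulr2n expr2; nra.
Qed.

Lemma sin_ge_half (s : R) : 0 <= s <= pi / 4 -> s / 2 <= sin s.
Proof.
move=> /andP[s0 s1]; have pi0 := pi_gt0 R.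
have cs : {within `[0, s], continuous (@sin R)}.
  by apply: continuous_subspaceT; exact: continuous_sin.
have [c] := MVT_segment s0 (fun x _ => is_derive_sin x) cs.
rewrite in_itv/= sin0 !subr0 => /andP[c0 c1] ->.
rewrite mulrC ler_wpM2r//; apply: (@le_trans _ _ (cos (pi / 4))).
  by have := cos_piquarter_ge; lra.
have [->|cn] := eqVneq c (pi / 4); first by [].
by apply: ltW; rewrite ltr_cos ?in_itv/=; [|lra|lra]; rewrite lt_neqAle cn/=; lra.
Qed.

(** A weak form of the Jordan inequality, by duplication from the range where
the derivative of the sine is at least one half. *)
Lemma norm_sin_ge (s : R) : `|s| <= pi / 2 -> `|s| / 4 <= `|sin s|.
Proof.
wlog s0 : s / 0 <= s => [wl|].
  have [|/ltW s0] := leP 0 s; first exact: wl.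
  by have := wl (- s); rewrite normrN sinN normrN; apply; lra.
rewrite ger0_norm// => s1; apply: le_trans (ler_norm _).
have -> : s = s / 2 *+ 2 by field.
rewrite sin_mulr2n mulr2n.
have h1 : s / 2 / 2 <= sin (s / 2) by apply: sin_ge_half; lra.
have h2 : 1 / 2 <= cos (s / 2).
  apply: (le_trans cos_piquarter_ge).
  have [->|cn] := eqVneq (s / 2) (pi / 4); first by [].
  have pi0 := pi_gt0 R.
  apply: ltW; rewrite ltr_cos ?in_itv/=; [|lra|lra].
  by rewrite lt_neqAle cn/=; lra.
nra.
Qed.

(** This bounds the singularity of the Dirichlet kernel: |sin ((t - x) / 2)| is
comparable to the distance from t to x modulo the period, even when t and x
are near opposite ends of the period. *)
Lemma chord_bound (L : R) h (x t : R) : 0 <= L -> periodic2pi h ->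
  (forall y z, `|h y - h z| <= L * `|y - z|) -> I x -> I t ->
  `|h t - h x| <= 8 * L * `|sin ((t - x) / 2)|.
Proof.
move=> L0 ph hL; rewrite /= !in_itv/= => /andP[x1 x2] /andP[t1 t2].
have key (u : R) : h u = h t -> `|(u - x) / 2| <= pi / 2 ->
    `|sin ((u - x) / 2)| = `|sin ((t - x) / 2)| ->
    `|h t - h x| <= 8 * L * `|sin ((t - x) / 2)|.
  move=> <- /norm_sin_ge + <-; set s := (u - x) / 2 => us.
  apply: (le_trans (hL _ _)); have -> : u - x = s * 2 by rewrite /s; field.
  rewrite normrM (ger0_norm (ler0n _ 2)); have := normr_ge0 s; nra.
have [c1|c1] := leP `|(t - x) / 2| (pi / 2); first exact: (key t).
have [c2|c2] := leP 0 (t - x).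
  apply: (key (t - pi *+ 2)).
  - by rewrite -ph subrK.
  - by move: c1; rewrite ger0_norm ?divr_ge0// ler_norml; lra.
  - rewrite (_ : (t - pi *+ 2 - x) / 2 = (t - x) / 2 - pi); last by field.
    by rewrite -normrN -sinDpi subrK.
apply: (key (t + pi *+ 2)).
- by rewrite ph.
- by move: c1; rewrite ltr0_norm ?pmulr_llt0 ?invr_gt0// ler_norml; lra.
- rewrite (_ : (t + pi *+ 2 - x) / 2 = (t - x) / 2 + pi); last by field.
  by rewrite sinDpi normrN.
Qed.

(** Multiplying by sin (u / 2) makes the sum of cosines telescope. *)
Lemma dirichlet_kernel (N : nat) (u : R) :
  sin (u / 2) * (\sum_(n <- iota 0 N.+1) wgt n * cos (n%:R * u)) =
  (pi *+ 2)^-1 * sin (N%:R * u + u / 2).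
Proof.
have pi0 : (pi : R) != 0 by rewrite gt_eqF// pi_gt0.
elim: N => [|N IH].
  by rewrite big_seq1 !mul0r cos0 add0r /wgt/= mulr1 mulrC.
rewrite -[N.+2]addn1 iotaD big_cat big_seq1 add0n mulrDr IH /wgt -(natr1 N) /=.
(* the sines of (N + 1) u +- u / 2 differ by 2 sin (u / 2) cos ((N + 1) u) *)
have -> : N%:R * u + u / 2 = (N%:R + 1) * u - u / 2 by field.
by rewrite sinB sinD; move: (pi : R) pi0 => p p0; field.
Qed.

(** By Bessel the energies form a convergent series. *)
Lemma riemann_lebesgue k b : sqint k -> coef k b n @[n --> \oo] --> 0.
Proof.
move=> sk; have pi0 := pi_gt0 R.
have e0 : energy k n @[n --> \oo] --> 0.
  apply: cvg_series_cvg_0; apply: nondecreasing_is_cvgn.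
    by apply: nondecreasing_series => n _ _; exact: energy_ge0.
  exists (ip k k) => _ [N _ <-].
  by rewrite /series/= /index_iota subn0; exact: bessel.
apply/cvgr0Pnorm_lt => e e_gt0.
have e'0 : 0 < (pi *+ 2)^-1 * e ^+ 2 by rewrite mulr_gt0 ?exprn_gt0// invr_gt0; lra.
move/cvgr0Pnorm_lt : e0 => /(_ _ e'0); apply: filterS => n.
rewrite ger0_norm ?energy_ge0// => en.
rewrite -ltr_sqr ?nnegrE ?(ltW e_gt0)// real_normK ?num_real//.
have w2 : (pi *+ 2)^-1 <= wgt n :> R.
  rewrite /wgt; case: ifP => // _; rewrite lef_pV2 ?posrE//; lra.
have c2 : coef k b n ^+ 2 <= coef k false n ^+ 2 + coef k true n ^+ 2.
  by case: b; rewrite ?lerDl ?lerDr sqr_ge0.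
rewrite -(@ltr_pM2l _ (pi *+ 2)^-1) ?invr_gt0; last lra.
apply: le_lt_trans en; rewrite /energy ler_pM ?sqr_ge0// invr_ge0; lra.
Qed.

Lemma fsumE h N x : sqint h ->
  fsum h N x = ip h (fun t => \sum_(n <- iota 0 N) wgt n * cos (n%:R * (t - x))).
Proof.
move=> sh; rewrite ipC.
have sc n : sqint (fun t => cos (n%:R * (t - x))).
  apply: (@sqint_bounded _ 1) => [|t _]; last exact: cos_max.
  rewrite (_ : (fun t => _) = fun t => cos (n%:R * t + (- (n%:R * x)))).
    apply: continuous_measurable_fun; exact: continuous_cos_affine.
  by apply/funext => t; congr cos; ring.
rewrite ip_suml//; last by move=> n; apply: sqintZ.
apply: eq_bigr => n _; rewrite ipZl//; congr (_ * _).
rewrite [RHS](_ : _ = ip (fun t => wave false n x * wave false n t +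
    wave true n x * wave true n t) h).
  have sw b : sqint (fun t => wave b n x * wave b n t) by exact/sqintZ/sqint_wave.
  by rewrite ipDl// !ipZl//; [|exact: sqint_wave..];
    rewrite !(ipC (wave _ _)) !(mulrC (wave _ _ _)).
congr ip; apply/funext => t.
by rewrite !wave_cos !wave_sin mulrBr cosB; ring.
Qed.

(** Subtracting h x and using the Dirichlet kernel, the error at x is, up to a
constant, the integral of (h t - h x) * sin ((N + 1 / 2) (t - x)) divided by
sin ((t - x) / 2). The quotient G is bounded, and expanding the sine of the sum
leaves Fourier coefficients of two bounded functions, which tend to 0. *)
Lemma fsum_lipschitz_cvg (L : R) h x : measurable_fun setT h ->
  periodic2pi h -> (forall y z, `|h y - h z| <= L * `|y - z|) -> I x ->
  fsum h N x @[N --> \oo] --> h x.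
Proof.
move=> mh ph hL Ix; have pi0 := pi_gt0 R.
have L0 : 0 <= L.
  by have := le_trans (normr_ge0 _) (hL 1 0); rewrite subr0 normr1 mulr1.
pose s t := sin ((t - x) / 2); pose c t := cos ((t - x) / 2).
pose G2 t := h t - h x; pose G t := G2 t / s t; pose G1 t := G t * c t.
have ma : measurable_fun setT (fun t : R => (t - x) / 2).
  by apply: continuous_measurable_fun => t; apply: cvgM;
    [apply: cvgB; [exact: cvg_id|exact: cvg_cst]|exact: cvg_cst].
have ms : measurable_fun setT s.
  exact: (measurableT_comp (continuous_measurable_fun (@continuous_sin R)) ma).
have mc : measurable_fun setT c.
  exact: (measurableT_comp (continuous_measurable_fun (@continuous_cos R)) ma).
have mG2 : measurable_fun setT G2 by apply: measurable_funB.
have mG : measurable_fun setT G.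
  by apply: measurable_funM => //; exact: (measurableT_comp measurable_invr ms).
have mG1 : measurable_fun setT G1 by apply: measurable_funM.
have cb t : I t -> `|G2 t| <= 8 * L * `|s t|.
  by move=> It; exact: chord_bound.
(* where the denominator vanishes so does the numerator, by the chord bound *)
have GE t : I t -> G2 t = G t * s t.
  move=> It; rewrite /G; have [s0|s0] := eqVneq (s t) 0; last by rewrite divfK.
  by rewrite s0 mulr0; apply/eqP; rewrite -normr_le0; have := cb t It;
    rewrite s0 normr0 mulr0.
have G8 t : I t -> `|G t| <= 8 * L.
  move=> It; rewrite /G normrM normfV.
  have [->|s0] := eqVneq (s t) 0; first by rewrite normr0 invr0 mulr0 mulr_ge0.
  by rewrite ler_pdivrMr ?normr_gt0// cb.
have sG1 : sqint G1.
  apply: (@sqint_bounded _ (8 * L)) => // t It; rewrite /G1 normrM.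
  by rewrite -[leRHS]mulr1 ler_pM ?G8// cos_max.
have sG2 : sqint G2.
  apply: (@sqint_bounded _ (8 * L)) => // t It; apply: le_trans (cb t It) _.
  by rewrite -[leRHS]mulr1 ler_wpM2l ?mulr_ge0// sin_max.
have sh : sqint h.
  have := sqintD sG2 (sqint_cst (h x)).
  by congr sqint; apply/funext => t; rewrite /G2 /= subrK.
pose D N t := \sum_(n <- iota 0 N.+1) wgt n * cos (n%:R * (t - x)).
have sD N : sqint (D N).
  apply: sqint_sum => n; apply: sqintZ; apply: (@sqint_bounded _ 1) => [|t _];
    last exact: cos_max.
  rewrite (_ : (fun t => _) = fun t => cos (n%:R * t + (- (n%:R * x)))).
    apply: continuous_measurable_fun; exact: continuous_cos_affine.
  by apply/funext => t; congr cos; ring.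
(* the constant 1 is the wave of frequency 0, so the kernel D N has integral 1 *)
have D1 N : fsum (cst 1) N.+1 x = 1.
  rewrite /fsum /= (_ : cst 1 = wave false 0); last first.
    by apply/funext => t; rewrite wave_cos mul0r cos0.
  rewrite big_cons big_seq big1 ?addr0.
    rewrite mulrDr !mulrA -[coef _ _ _]/(ip _ _) -[coef _ true _]/(ip _ _).
    by rewrite !wave_orthonormal /= wave_cos !mul0r cos0 mulr1 addr0.
  move=> n; rewrite mem_iota => /andP[n0 _].
  rewrite mulrDr !mulrA /coef !(ipC (wave false 0)) !wave_orthonormal.
  by rewrite !gtn_eqF//= !mul0r addr0.
have key N : fsum h N.+1 x - h x = (pi *+ 2)^-1 *
    ((cos (N%:R * x) * coef G1 true N - sin (N%:R * x) * coef G1 false N) +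
     (cos (N%:R * x) * coef G2 false N + sin (N%:R * x) * coef G2 true N)).
  have -> : h x = h x * fsum (cst 1) N.+1 x by rewrite D1 mulr1.
  rewrite (fsumE _ _ sh) (fsumE _ _ (sqint_cst 1)).
  rewrite -(ipZl (h x) (sqint_cst 1) (sD N)).
  rewrite -(ipBl sh (sqintZ (h x) (sqint_cst 1)) (sD N)).
  transitivity (ip (fun t => (pi *+ 2)^-1 *
     (G1 t * (sin (N%:R * (t - x))) + G2 t * cos (N%:R * (t - x)))) (cst 1)).
    apply: eq_Rintegral => t; rewrite inE => It /=;
      rewrite !mulr1 -/(G2 t) (GE t It) -mulrA.
    rewrite (dirichlet_kernel N (t - x)) sinD /G1 -/(s t) -/(c t); ring.
  have sw (g : R -> R) b : sqint g -> sqint (fun t => g t * wave b N t).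
    move=> [mg ig]; split.
      by apply: measurable_funM => //; exact: measurable_wave.
    apply: le_integrable ig => //.
      apply/measurable_EFinP/measurable_funTS/measurable_funX.
      by apply: measurable_funM => //; exact: measurable_wave.
    move=> t _ /=; rewrite lee_fin !normrX normrM exprMn.
    by rewrite -[leRHS]mulr1 ler_wpM2l ?sqr_ge0// expr_le1// cos_max.
  have c1E g b : sqint g -> ip (fun t => g t * wave b N t) (cst 1) = coef g b N.
    by move=> sg; apply: eq_Rintegral => t _; rewrite mulr1.
  rewrite [LHS](_ : _ = ip (fun t => (pi *+ 2)^-1 *
     ((cos (N%:R * x) * (G1 t * wave true N t) +
       - sin (N%:R * x) * (G1 t * wave false N t)) +
      (cos (N%:R * x) * (G2 t * wave false N t) +
       sin (N%:R * x) * (G2 t * wave true N t)))) (cst 1)).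
    have s1 := sqint_cst 1.
    have sZ (g : R -> R) b a : sqint g -> sqint (fun t => a * (g t * wave b N t)).
      by move=> sg; apply: sqintZ; exact: sw.
    rewrite ipZl//; last by do !apply: sqintD; exact: sZ.
    by rewrite !ipDl ?ipZl ?c1E ?mulNr//;
      do ?[exact: sZ|exact: sw|apply: sqintD; exact: sZ].
  apply: eq_Rintegral => t _; rewrite !wave_cos !wave_sin mulrBr sinB cosB; ring.
rewrite -(cvg_shiftS (fun N => fsum h N x)) /=.
apply/subr_cvg0.
rewrite (_ : (fun N => _) = (fun N => (pi *+ 2)^-1 *
    ((cos (N%:R * x) * coef G1 true N - sin (N%:R * x) * coef G1 false N) +
     (cos (N%:R * x) * coef G2 false N + sin (N%:R * x) * coef G2 true N))));
       last first.
  by apply/funext => N; exact: key.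
have bz (a g : nat -> R) : (forall N, `|a N| <= 1) -> g N @[N --> \oo] --> 0 ->
    a N * g N @[N --> \oo] --> 0.
  move=> a1 /cvgr0Pnorm_lt g0; apply/cvgr0Pnorm_lt => e e_gt0.
  apply: filterS (g0 e e_gt0) => N; apply: le_lt_trans; rewrite normrM.
  by rewrite -[leRHS]mul1r ler_wpM2r.
have bc N : `|cos (N%:R * x)| <= 1 := cos_max _.
have bs N : `|sin (N%:R * x)| <= 1 := sin_max _.
rewrite -(mulr0 (pi *+ 2)^-1); apply: cvgM; first exact: cvg_cst.
rewrite -(addr0 0); apply: cvgD.
  rewrite -(subr0 0); apply: cvgB; apply: bz => //; exact: riemann_lebesgue.
rewrite -(addr0 0); apply: cvgD; apply: bz => //; exact: riemann_lebesgue.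
Qed.

End pointwise_convergence.

(** * Moving averages of periodic functions *)

Section averages.
Context {R : realType}.
Local Notation mu := (@lebesgue_measure R).
Local Notation I := `[- pi, (pi : R)]%classic.
Implicit Types h k g : R -> R.

Definition avg (e : R) h (x : R) : R :=
  (2 * e)^-1 * \int[mu]_(y in `[- e, e]) h (x - y).

Definition psqint h := sqint h /\ periodic2pi h.

(** The multiplier phihat on nonnegative frequencies. *)
Definition phi (e : R) (n : nat) : R :=
  if n == 0%N then 1 else sin (n%:R * e) / (n%:R * e).

Lemma psqint_integrable h a b : psqint h -> mu.-integrable `[a, b] (EFin \o h).
Proof.
by move=> [sh ph]; apply: periodic_integrable_itv => //;
  [case: sh|exact: integrable_sqint].
Qed.

Lemma Rintegral_reflect h (a b c : R) : measurable_fun setT h ->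
  \int[mu]_(y in `[a, b]) h (c - y) = \int[mu]_(y in `[c - b, c - a]) h y.
Proof.
move=> mh; rewrite /Rintegral; congr fine.
by apply: (@integral_reflect _ (EFin \o h)); exact/measurable_EFinP.
Qed.

Lemma avgE (e : R) h x : measurable_fun setT h ->
  avg e h x = (2 * e)^-1 * \int[mu]_(y in `[x - e, x + e]) h y.
Proof. by move=> mh; rewrite /avg Rintegral_reflect// opprK. Qed.

Lemma avg_periodic e h : periodic2pi h -> periodic2pi (avg e h).
Proof.
move=> ph x; congr (_ * _); apply: eq_Rintegral => y _.
by rewrite -[in RHS]ph; congr h; ring.
Qed.

Let E (e : R) : set (measurableTypeR R) := `[- e, e]%classic.

Lemma measurable_sub_pair h : measurable_fun setT h ->
  measurable_fun setT
    (fun z : measurableTypeR R * measurableTypeR R => h (z.1 - z.2)).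
Proof.
move=> mh; apply: (measurableT_comp mh).
by apply: measurable_funB.
Qed.

Let kern (e : R) h (z : measurableTypeR R * measurableTypeR R) : R :=
  h (z.1 - z.2) * \1_(E e) z.2.

Let measurable_kern e h : measurable_fun setT h -> measurable_fun setT (kern e h).
Proof.
move=> mh; apply: measurable_funM.
  exact: measurable_sub_pair.
apply: (measurableT_comp (measurable_indic _)) => //.
exact: measurable_itv.
Qed.

Let kernE e h x :
  (\int[mu]_(y in E e) (h (x - y))%:E = \int[mu]_y (kern e h (x, y))%:E)%E.
Proof.
rewrite integral_mkcond; apply: eq_integral => y _.
by rewrite /kern/= patchE indicE; case: ifP => _; rewrite ?mulr1 ?mulr0.
Qed.

(** The average is a section integral of a jointly measurable function; its
positive and negative parts are measurable by Tonelli. *)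
Lemma measurable_avg e h : measurable_fun setT h -> measurable_fun setT (avg e h).
Proof.
move=> mh; apply: measurable_funM => //.
apply: (measurableT_comp (fine_measurable _)) => //.
rewrite (_ : (fun x => _) = fun x => \int[mu]_y (kern e h (x, y))%:E)%E; last first.
  by apply/funext => x; exact: kernE.
pose f := EFin \o kern e h.
have mf : measurable_fun setT f by apply/measurable_EFinP; exact: measurable_kern.
rewrite (_ : (fun x => _) = (fun x => \int[mu]_y f^\+ (x, y)) \-
   (fun x => \int[mu]_y f^\- (x, y)))%E; last first.
  apply/funext => x; rewrite [LHS]integralE.
  under eq_integral do rewrite (funepos_comp f (fun y => (x, y))).
  by under [X in (_ - X)%E]eq_integral do rewrite (funeneg_comp f (fun y => (x, y))).
apply: emeasurable_funB.
- exact: (@measurable_fun_fubini_tonelli_F _ _ _ _ _ mu _ (measurable_funepos mf)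
    (funepos_ge0 f)).
- exact: (@measurable_fun_fubini_tonelli_F _ _ _ _ _ mu _ (measurable_funeneg mf)
    (funeneg_ge0 f)).
Qed.

Lemma norm_avg_le e h x (M : R) : 0 < e -> psqint h ->
  \int[mu]_(y in `[x - e, x + e]) `|h y| <= M -> `|avg e h x| <= (2 * e)^-1 * M.
Proof.
move=> e0 ph hM; have mh := ph.1.1.
rewrite avgE// normrM gtr0_norm ?invr_gt0 ?mulr_gt0//.
rewrite ler_wpM2l ?invr_ge0 ?mulr_ge0 ?(ltW e0)//; apply: le_trans hM.
by apply: le_normr_Rintegral; [exact: measurable_itv|exact: psqint_integrable].
Qed.

(** Over one period all the windows lie in one bounded interval. *)
Lemma avg_bounded e h : 0 < e -> psqint h ->
  exists M : R, forall x, `|avg e h x| <= M.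
Proof.
move=> e0 ph; have pi0 := pi_gt0 R.
pose M0 := \int[mu]_(y in `[- pi - e, pi + e]) `|h y|.
exists ((2 * e)^-1 * M0).
have inI x : I x -> `|avg e h x| <= (2 * e)^-1 * M0.
  rewrite /= in_itv/= => /andP[x1 x2]; apply: norm_avg_le => //.
  rewrite /M0 /Rintegral fine_le//.
  - apply: integrable_fin_num; first exact: measurable_itv.
    have := integrable_norm (psqint_integrable (x - e) (x + e) ph).
    exact.
  - apply: integrable_fin_num; first exact: measurable_itv.
    have := integrable_norm (psqint_integrable (- pi - e) (pi + e) ph).
    exact.
  - apply: ge0_subset_integral => //.
    + apply/measurable_EFinP/measurable_funTS; apply: measurableT_comp => //.
      by case: ph => -[].
    + by move=> y; rewrite /= !in_itv/=; lra.
move=> x; pose k := Num.floor ((x + pi) / (pi *+ 2)).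
have p20 : 0 < (pi : R) *+ 2 by rewrite pmulrn_rgt0.
have := floor_itv ((x + pi) / (pi *+ 2)).
rewrite -/k ler_pdivlMr // ltr_pdivrMr // => /andP[k1 k2].
rewrite -[x](subrK (k%:~R * (pi *+ 2))) periodicz; last exact: avg_periodic ph.2.
apply: inI; rewrite /= in_itv/=; move: k1 k2; rewrite intrD mulrDl mul1r.
move: (_ * _) => z; lra.
Qed.

Lemma psqint_avg e h : 0 < e -> psqint h -> psqint (avg e h).
Proof.
move=> e0 ph; have [M hM] := avg_bounded e0 ph.
split; last exact: avg_periodic ph.2.
by apply: (@sqint_bounded _ M) => //; apply: measurable_avg; case: ph => -[].
Qed.

Lemma Rintegral_itv_split h (a c b : R) : a <= c -> c <= b ->
  mu.-integrable `[a, b] (EFin \o h) ->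
  \int[mu]_(y in `[a, b]) h y =
  \int[mu]_(y in `[a, c]) h y + \int[mu]_(y in `[c, b]) h y.
Proof.
move=> ac cb ih; rewrite -(@Rintegral_itv_obnd_cbnd _ c); last first.
  by apply: integrableS ih => //; apply: subset_itvr; rewrite bnd_simp.
by rewrite -(@Rintegral_itvB _ h (BLeft a) (BRight b) c)// ?bnd_simp// addrC subrK.
Qed.

Lemma Rintegral_itv_bounded h (a b M : R) : measurable_fun setT h ->
  (forall x, `|h x| <= M) -> a <= b ->
  `|\int[mu]_(y in `[a, b]) h y| <= M * (b - a).
Proof.
move=> mh hM ab; have ih := @integrable_bounded_itv _ a b M h mh (fun x _ => hM x).
apply: le_trans (le_normr_Rintegral _ _) _ => //.
apply: (@le_trans _ _ (\int[mu]_(y in `[a, b]) M)).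
  apply: le_Rintegral => //; [exact: integrable_norm|exact: integrable_cst_itv].
rewrite Rintegral_cst//= lebesgue_measure_itv/= lte_fin.
by move: ab; rewrite le_eqVlt => /predU1P[->|->]; rewrite ?ltxx ?subrr ?mulr0.
Qed.

(** Two windows of equal length differ by two intervals of length |x - y|. *)
Lemma avg_lipschitz e h M : 0 < e -> measurable_fun setT h ->
  (forall x, `|h x| <= M) ->
  forall x y, `|avg e h x - avg e h y| <= (M / e) * `|x - y|.
Proof.
move=> e0 mh hM x y.
wlog yx : x y / y <= x => [wl|].
  have [|/ltW] := leP y x; first exact: wl.
  by move=> /wl; rewrite distrC (distrC y).
have ih a b := @integrable_bounded_itv _ a b M h mh (fun x _ => hM x).
have yx1 : y - e <= x - e by lra.
have yx2 : y + e <= x + e by lra.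
have xx : x - e <= x + e by lra.
have yy : y - e <= y + e by lra.
have s1 := Rintegral_itv_split yx1 xx (ih _ _).
have s2 := Rintegral_itv_split yy yx2 (ih _ _).
have b1 := Rintegral_itv_bounded mh hM yx1.
have b2 := Rintegral_itv_bounded mh hM yx2.
rewrite !avgE// -mulrBr normrM gtr0_norm ?invr_gt0 ?mulr_gt0//.
rewrite (ger0_norm (_ : 0 <= x - y)) ?subr_ge0//.
rewrite invfM (_ : M / e * (x - y) = 2^-1 * e^-1 * (M * (x - y) *+ 2)); last first.
  by rewrite mulr2n; field; rewrite gt_eqF.
rewrite ler_wpM2l ?mulr_ge0 ?invr_ge0 ?(ltW e0)//.
move: b1 b2; rewrite (_ : x - e - (y - e) = x - y); last by ring.
rewrite (_ : x + e - (y + e) = x - y); last by ring.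
rewrite mulr2n => b1 b2; apply: le_trans (lerD b2 b1); apply: le_trans (ler_normB _ _).
by rewrite le_eqVlt; apply/orP; left; apply/eqP; congr `|_|; move: s1 s2; lra.
Qed.

Lemma integrable_reflect h x a b : psqint h ->
  mu.-integrable `[a, b] (EFin \o (fun y => h (x - y))).
Proof.
move=> ph; have mh := ph.1.1; apply/integrableP; split.
  apply/measurable_EFinP/measurable_funTS.
  exact: (measurableT_comp mh (measurable_reflect_at x)).
have /integrableP[_] := psqint_integrable (x - b) (x - a) ph.
rewrite -(@integral_reflect _ (fun y => `|(EFin \o h) y|%E))//.
by apply: measurableT_comp => //; exact/measurable_EFinP.
Qed.

Lemma integral_norm_shift h y : psqint h ->
  (\int[mu]_(x in I) `|(h (x - y))%:E| = \int[mu]_(x in I) `|(h x)%:E|)%E.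
Proof.
move=> ph; have mh := ph.1.1.
apply: (@integral_periodic_shift _ (fun x => `|(h x)%:E|%E) (- y)).
  by apply: measurableT_comp => //; exact/measurable_EFinP.
by move=> x; rewrite ph.2.
Qed.

Lemma integrable_mul_bounded (D : set (measurableTypeR R)) (M : R) h g :
  measurable D -> measurable_fun setT g ->
  (forall x, `|g x| <= M) -> mu.-integrable D (EFin \o h) ->
  mu.-integrable D (EFin \o (fun x => h x * g x)).
Proof.
move=> mD mg gM ih; have := integrableZl mD M ih.
apply: le_integrable => //.
  apply/measurable_EFinP/measurable_funM.
    by case/integrableP : ih => /measurable_EFinP.
  exact: measurable_funTS.
move=> x _ /=; rewrite lee_fin !normrM mulrC ler_wpM2r//.
by rewrite (le_trans (gM x))// ler_norm.
Qed.

Lemma integral_EFin_fine (D : set (measurableTypeR R)) h :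
  measurable D -> mu.-integrable D (EFin \o h) ->
  (\int[mu]_(x in D) (h x)%:E)%E = (\int[mu]_(x in D) h x)%:E.
Proof.
by move=> mD ih; rewrite /Rintegral fineK//; exact: integrable_fin_num.
Qed.

Lemma integrable_shift h g y : psqint h -> measurable_fun setT g ->
  (forall x, `|g x| <= 1) ->
  mu.-integrable I (EFin \o (fun x => h (x - y) * g x)).
Proof.
move=> ph mg g1; have mh := ph.1.1.
apply: (@integrable_mul_bounded _ 1) => //.
apply/integrableP; split.
  apply/measurable_EFinP/measurable_funTS; apply: (measurableT_comp mh).
  by apply: measurable_funB.
rewrite [ltLHS](integral_norm_shift y ph).
by have /integrableP[] := psqint_integrable (- pi) pi ph.
Qed.

(** This is Fubini on the product of the period and the window. *)
Lemma ip_avg e h g : 0 < e -> psqint h -> measurable_fun setT g ->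
  (forall x, `|g x| <= 1) ->
  ip (avg e h) g =
  (2 * e)^-1 * \int[mu]_(y in `[- e, e]) \int[mu]_(x in I) (h (x - y) * g x).
Proof.
move=> e0 ph mg g1; have mh := ph.1.1.
have mI : measurable (I : set (measurableTypeR R)) by exact: measurable_itv.
have mE : measurable (E e) by exact: measurable_itv.
pose a0 x := \int[mu]_(y in E e) h (x - y).
have a0E : a0 = fun x => (2 * e) * avg e h x.
  by apply/funext => x; rewrite /avg mulVKf// mulf_neq0// gt_eqF.
have sa0 : sqint a0 by rewrite a0E; exact/sqintZ/(psqint_avg e0 ph).1.
have sg : sqint g by apply: (@sqint_bounded _ 1).
rewrite (_ : avg e h = fun x => (2 * e)^-1 * a0 x)// ipZl//; congr (_ * _).
(* extended by 0, the integrand gives iterated integrals over the whole line *)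
pose F z := kern e h z * (g z.1 * \1_I z.1).
have mF : measurable_fun setT (EFin \o F).
  apply/measurable_EFinP/measurable_funM; first exact: measurable_kern.
  apply: measurable_funM; first exact: (measurableT_comp mg).
  by apply: (measurableT_comp (measurable_indic _)).
have mFa : measurable_fun setT (abse \o (EFin \o F)) by exact: measurableT_comp.
have mpair (y : measurableTypeR R) :
    measurable_fun setT (fun x : measurableTypeR R => (x, y)).
  by apply: measurable_fun_pair => //; exact: measurable_cst.
pose H := \int[mu]_(x in I) `|h x|.
have HE : (\int[mu]_(x in I) `|(h x)%:E| = H%:E)%E.
  by rewrite /H /Rintegral fineK//; apply: integrable_fin_num => //;
    exact: integrable_norm (psqint_integrable (- pi) pi ph).
have iF : (mu \x mu)%E.-integrable setT (EFin \o F).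
  apply/(integrable21ltyP _ _ mF).
  apply: (@le_lt_trans _ _ (\int[mu]_(y in E e) H%:E)%E); last first.
    rewrite integral_cst//= lebesgue_measure_itv/=; case: ifP => _.
      by rewrite -EFinD -EFinM ltry.
    by rewrite mule0.
  rewrite [leRHS]integral_mkcond; apply: ge0_le_integral => //.
  - by move=> y _; exact: integral_ge0.
  - apply: (@measurable_fun_fubini_tonelli_G _ _ _ _ _ mu (abse \o (EFin \o F))).
      exact: mFa.
    by move=> z; exact: abse_ge0.
  - exact: ((measurable_restrictT (fun _ => H%:E) mE).1 (measurable_cst _)).
  move=> y _; rewrite patchE; case: ifPn => yE; last first.
    rewrite integral0_eq// => x _.
    by rewrite /F /kern /= indicE (negbTE yE) mulr0 mul0r normr0.
  rewrite -HE -(integral_norm_shift y ph) [leRHS]integral_mkcond.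
  apply: ge0_le_integral => //.
  - exact: (measurableT_comp mFa (mpair y)).
  - apply: (measurable_restrictT _ mI).1.
    apply: measurableT_comp => //; apply/measurable_EFinP/measurable_funTS.
    by apply: (measurableT_comp mh); apply: measurable_funB.
  move=> x _; rewrite patchE /F /kern/= !indicE yE mulr1.
  case: ifP => _; last by rewrite !mulr0 normr0.
  by rewrite mulr1 lee_fin normrM -[leRHS]mulr1 ler_wpM2l.
have := Fubini iF; rewrite /=.
rewrite [X in X = _ -> _](_ : _ = \int[mu]_(x in I) (a0 x * g x)%:E)%E; last first.
  rewrite [RHS]integral_mkcond; apply: eq_integral => x _.
  rewrite patchE; case: ifPn => xI; last first.
    by rewrite integral0_eq// => y _; rewrite /F /= indicE (negbTE xI) !mulr0.
  rewrite /a0 -RintegralZr//; last exact: integrable_reflect.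
  rewrite -integral_EFin_fine//; last first.
    apply: (@integrable_mul_bounded _ `|g x| _ (cst (g x))) => //.
    exact: integrable_reflect.
  rewrite [RHS]integral_mkcond; apply: eq_integral => y _.
  by rewrite patchE /F /kern /= !indicE xI mulr1; case: ifP => _;
    rewrite ?mulr1 ?mulr0 ?mul0r.
rewrite [X in _ = X -> _](_ : _ =
    \int[mu]_(y in E e) (\int[mu]_(x in I) (h (x - y) * g x))%:E)%E; last first.
  rewrite [RHS]integral_mkcond; apply: eq_integral => y _.
  rewrite patchE; case: ifPn => yE; last first.
    by rewrite integral0_eq// => x _;
      rewrite /F /kern /= indicE (negbTE yE) mulr0 mul0r.
  rewrite -integral_EFin_fine//; last exact: integrable_shift.
  rewrite [RHS]integral_mkcond; apply: eq_integral => x _.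
  by rewrite patchE /F /kern /= !indicE yE mulr1; case: ifP => _; rewrite ?mulr1 ?mulr0.
by move=> HF; rewrite /ip /Rintegral -HF.
Qed.

End averages.

(** * Averages as Fourier multipliers and the completeness of the trigonometric system *)

Section parseval.
Context {R : realType}.
Local Notation mu := (@lebesgue_measure R).
Local Notation I := `[- pi, (pi : R)]%classic.
Implicit Types h k g : R -> R.

Lemma integral_cos_phi (e : R) n : 0 < e ->
  \int[mu]_(y in `[- e, e]) cos (n%:R * y) = 2 * e * phi e n.
Proof.
move=> e0; rewrite /phi; have ee : - e < e by lra.
have [->|n0] := eqVneq n 0%N.
  under eq_Rintegral do rewrite mul0r cos0.
  rewrite Rintegral_cst//= lebesgue_measure_itv/= lte_fin ee/=; ring.
have n0' : n%:R != 0 :> R by rewrite pnatr_eq0.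
have := integral_cos_affine 0 n0' ee.
under eq_Rintegral do rewrite addr0.
move=> ->; rewrite !addr0 mulrN sinN; field.
by rewrite gt_eqF.
Qed.

Lemma integral_sin_sym (e : R) n : 0 < e ->
  \int[mu]_(y in `[- e, e]) sin (n%:R * y) = 0.
Proof.
move=> e0; have ee : - e < e by lra.
have [->|n0] := eqVneq n 0%N.
  under eq_Rintegral do rewrite mul0r sin0.
  by rewrite Rintegral_cst// mul0r.
have n0' : n%:R != 0 :> R by rewrite pnatr_eq0.
have := integral_cos_affine (- (pi / 2)) n0' ee.
under eq_Rintegral do rewrite cosBpihalf.
by move=> ->; rewrite !sinBpihalf mulrN cosN subrr mul0r.
Qed.

Lemma phi_le1 (e : R) n : 0 < e -> `|phi e n| <= 1.
Proof.
move=> e0; have := @Rintegral_itv_bounded R (fun y => cos (n%:R * y)) (- e) e 1.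
rewrite integral_cos_phi// normrM gtr0_norm ?mulr_gt0// => b.
have : 2 * e * `|phi e n| <= 1 * (e - - e).
  apply: b; last lra.
    rewrite (_ : (fun y => _) = wave false n).
      exact: measurable_wave.
    by apply/funext => x; rewrite wave_cos.
  by move=> x; exact: cos_max.
have e2 : 0 < 2 * e by lra.
by move=> b'; rewrite -(ler_pM2l e2) mulr1; move: b'; lra.
Qed.

Lemma wave_periodic b n : periodic2pi (@wave R b n).
Proof.
have pc : periodic2pi (@cos R) by move=> y; exact: cosD2pi.
move=> x; rewrite /wave -(periodicz pc n (n%:R * x + phase b)) -pmulrn.
by congr cos; ring.
Qed.

(** By [ip_avg] and invariance of the integral under translation, the inner
integral is a combination of cos (n y) and sin (n y), and the sine part
integrates to 0 over the symmetric window. *)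
Lemma coef_avg (e : R) h b n : 0 < e -> psqint h ->
  coef (avg e h) b n = phi e n * coef h b n.
Proof.
move=> e0 ph; have mh := ph.1.1.
have mw := @measurable_wave R b n.
rewrite /coef ip_avg//; last by move=> x; exact: cos_max.
pose s x : R := sin (n%:R * x + phase b).
have ss : sqint s.
  apply: (@sqint_bounded _ 1) => [|x _]; last exact: sin_max.
  rewrite (_ : s = fun x => cos (n%:R * x + (phase b - pi / 2))).
    by apply: continuous_measurable_fun; exact: continuous_cos_affine.
  by apply/funext => x; rewrite addrA cosBpihalf.
have inner y : \int[mu]_(x in I) (h (x - y) * wave b n x) =
    ip h (wave b n) * cos (n%:R * y) - ip h s * sin (n%:R * y).
  transitivity (\int[mu]_(x in I) (h x * wave b n (x + y))).
    rewrite /Rintegral; congr fine.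
    rewrite -(@integral_periodic_shift R
       (fun x => (h x * wave b n (x + y))%:E) (- y)).
    - by apply: eq_integral => x _; rewrite subrK.
    - apply/measurable_EFinP/measurable_funM => //.
      apply: (measurableT_comp mw).
      by apply: measurable_funD.
    - by move=> x; rewrite ph.2 addrAC wave_periodic.
  have sw := @sqint_wave R b n.
  rewrite mulrC [X in _ - X]mulrC !(ipC h) -!ipZl//; try exact: ph.1.
  rewrite -ipBl//; [|exact: sqintZ|exact: sqintZ|exact: ph.1].
  apply: eq_Rintegral => x _; rewrite [LHS]mulrC; congr (_ * _).
  rewrite /wave /s (_ : n%:R * (x + y) + phase b = n%:R * y + (n%:R * x + phase b));
    last by ring.
  by rewrite cosD mulrC [in RHS]mulrC; ring.
under eq_Rintegral do rewrite inner.
have ibnd (f : R -> R) : measurable_fun setT f -> (forall x, `|f x| <= 1) ->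
    mu.-integrable `[- e, e] (EFin \o f).
  by move=> mf f1; apply: (@integrable_bounded_itv _ _ _ 1).
have ic : mu.-integrable `[- e, e] (EFin \o (fun y => cos (n%:R * y))).
  apply: ibnd => [|x]; last exact: cos_max.
  rewrite (_ : (fun y => _) = wave false n); first exact: measurable_wave.
  by apply/funext => x; rewrite wave_cos.
have isn : mu.-integrable `[- e, e] (EFin \o (fun y => sin (n%:R * y))).
  apply: ibnd => [|x]; last exact: sin_max.
  rewrite (_ : (fun y => _) = wave true n); first exact: measurable_wave.
  by apply/funext => x; rewrite wave_sin.
have mE : measurable (`[- e, e]%classic : set (measurableTypeR R)) by exact:
  measurable_itv.
rewrite RintegralB//; last 2 first.
  exact: (integrableZl mE (ip h (wave b n)) ic).
  exact: (integrableZl mE (ip h s) isn).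
rewrite !RintegralZl// integral_cos_phi// integral_sin_sym// mulr0 subr0.
by field; rewrite gt_eqF.
Qed.

Lemma energy_avg_le (e : R) h n : 0 < e -> psqint h ->
  energy (avg e h) n <= energy h n.
Proof.
move=> e0 ph; rewrite /energy !coef_avg// !exprMn -mulrDr mulrCA ler_piMl//.
  exact: energy_ge0.
by rewrite -real_normK ?num_real// expr_le1// phi_le1.
Qed.

(** The lemma of Fatou in the form in which every passage to the limit of an
energy inequality below uses it. *)
Lemma fatou_sqint (u : nat -> R -> R) h (B : R) :
  (forall m, sqint (u m)) -> sqint h -> (forall m, ip (u m) (u m) <= B) ->
  (\forall x \ae mu, I x -> u m x @[m --> \oo] --> h x) -> ip h h <= B.
Proof.
move=> su sh uB uh; rewrite -lee_fin -integral_sqr//.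
have mI : measurable (I : set (measurableTypeR R)) by exact: measurable_itv.
pose f m x := (u m x ^+ 2)%:E.
have mf m : measurable_fun I (f m).
  by apply/measurable_EFinP/measurable_funTS/measurable_funX; case: (su m).
have f0 m x : I x -> (0 <= f m x)%E by move=> _; rewrite lee_fin sqr_ge0.
have einfs_cvg (v : (\bar R)^nat) : einfs v n @[n --> \oo] --> limn_einf v.
  by rewrite limn_einf_lim; exact: is_cvg_einfs.
have mlim : measurable_fun I (fun x => limn_einf (f^~ x)).
  apply: (emeasurable_fun_cvg (fun n x => einfs (f^~ x) n)) => [n|x _].
    exact: measurable_fun_einfs.
  exact: einfs_cvg.
apply: (@le_trans _ _ (\int[mu]_(x in I) limn_einf (f^~ x))%E).
  apply: ae_ge0_le_integral => //.
  - by move=> x _; rewrite lee_fin sqr_ge0.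
  - by apply/measurable_EFinP/measurable_funTS/measurable_funX; case: sh.
  - move=> x Ix; rewrite limn_einf_lim; apply: lime_ge; first exact: is_cvg_einfs.
    by apply: nearW => n; apply: le_ereal_inf_tmp => _ [m _ <-]; exact: f0.
  - apply: (@filterS _ _ (ae_filter_ringOfSetsType mu) _ _ _ uh) => x ux Ix.
    have uc : f m x @[m --> \oo] --> (h x ^+ 2)%:E.
      by apply: cvg_EFin; [exact: nearW|apply: cvgM; exact: ux].
    by have [-> _] := cvg_limn_einf_sup uc.
apply: (le_trans (fatou mu mI mf f0)).
rewrite limn_einf_lim; apply: lime_le; first exact: is_cvg_einfs.
apply: nearW => n; apply: (@le_trans _ _ (\int[mu]_(x in I) f n x)%E).
  by apply: ereal_inf_lbound; exists n => //=.
by rewrite integral_sqr// lee_fin.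
Qed.

Definition parseval_le h := forall B : R,
  (forall N, \sum_(n <- iota 0 N) energy h n <= B) -> ip h h <= B.

Lemma parseval_le_lipschitz (L : R) h : sqint h -> periodic2pi h ->
  (forall y z, `|h y - h z| <= L * `|y - z|) -> parseval_le h.
Proof.
move=> sh ph hL B hB; apply: (@fatou_sqint (fsum h)) => //.
- by move=> m; exact: sqint_fsum.
- by move=> m; rewrite ip_fsum_self.
- by apply: aeW => x Ix; apply: (fsum_lipschitz_cvg _ ph hL) => //; case: sh.
Qed.

(** The deviation of the average from h x is at most the mean deviation over
the window, which tends to 0 at a Lebesgue point by definition. *)
Lemma avg_lebesgue_pt h x : psqint h -> lebesgue_pt h x ->
  avg m.+1%:R^-1 h x @[m --> \oo] --> h x.
Proof.
move=> ph hx; have mh := ph.1.1.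
pose r (m : nat) : R := m.+1%:R^-1.
have r0 m : 0 < r m by rewrite invr_gt0.
have rcvg : r m @[m --> \oo] --> 0 by exact: cvg_harmonic.
have dcvg : davg h x (r m) @[m --> \oo] --> 0%E.
  by move/cvge_at_rightP : hx; apply.
have le_davg m : (`|avg (r m) h x - h x|%:E <= davg h x (r m))%E.
  rewrite /davg /iavg (lebesgue_measure_ball _ (ltW (r0 m))) ball_itv.
  have ic : mu.-integrable `[x - r m, x + r m] (EFin \o (fun y => h y - h x)).
    have mJ : measurable (`[x - r m, x + r m]%classic : set (measurableTypeR R)).
      exact: measurable_itv.
    exact: (integrableB mJ (psqint_integrable _ _ ph) (integrable_cst_itv _ _ (h x))).
  rewrite -(@integral_itv_bndoo _ _ _ _ true false); last first.
    by apply/measurable_funTS/measurableT_comp => //;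
      apply/measurable_EFinP/measurable_funB.
  rewrite inver gt_eqF ?pmulrn_rgt0//.
  have -> : avg (r m) h x - h x =
      (2 * r m)^-1 * \int[mu]_(y in `[x - r m, x + r m]) (h y - h x).
    rewrite RintegralB//; [|exact: psqint_integrable|exact: integrable_cst_itv].
    rewrite mulrBr avgE//; congr (_ - _).
    rewrite Rintegral_cst//= lebesgue_measure_itv/= lte_fin.
    rewrite ifT; last by have := r0 m; lra.
    rewrite /= (_ : x + r m - (x - r m) = 2 * r m); last by ring.
    by rewrite mulrCA mulVf ?mulr1// gt_eqF// mulr_gt0.
  rewrite normrM gtr0_norm ?invr_gt0 ?mulr_gt0// EFinM -(mulr_natl (r m) 2).
  rewrite lee_pmul2l// ?lte_fin ?invr_gt0 ?mulr_gt0//.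
  rewrite EFin_normr_Rintegral//.
  apply: le_abse_integral => //.
  by case/integrableP : ic.
apply/subr_cvg0/norm_cvg0P.
have : (`|avg (r m) h x - h x|%:E)%E @[m --> \oo] --> (0%R)%:E.
  apply: (@squeeze_cvge _ _ _ _ (cst 0%E) _ (fun m => davg h x (r m))) => //.
    by apply: nearW => m; rewrite le_davg andbT lee_fin.
  exact: cvg_cst.
by move/fine_cvg.
Qed.

(** Almost everywhere convergence of the averages together with
[energy_avg_le], which bounds the energies of the averages by those of h. *)
Lemma parseval_le_avg h : psqint h ->
  (forall d, 0 < d -> parseval_le (avg d h)) -> parseval_le h.
Proof.
move=> ph hd B hB; have mh := ph.1.1.
have r0 m : 0 < m.+1%:R^-1 :> R by rewrite invr_gt0.
apply: (@fatou_sqint (fun m => avg m.+1%:R^-1 h)).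
- by move=> m; exact: (psqint_avg (r0 m) ph).1.
- exact: ph.1.
- move=> m; apply: (hd _ (r0 m)) => N; apply: le_trans (hB N).
  by apply: ler_sum => n _; exact: energy_avg_le.
- have : locally_integrable setT h.
    split => //; first exact: openT.
    move=> K _ cK; have [M [_ /(_ (`|M| + 1))]] := compact_bounded cK.
    rewrite (le_lt_trans (ler_norm M)) ?ltrDl// => /(_ isT) KM.
    have /integrableP[_] := psqint_integrable (- (`|M| + 1)) (`|M| + 1) ph.
    apply: le_lt_trans; apply: ge0_subset_integral => //.
    + exact: compact_measurable.
    + by apply/measurable_EFinP/measurable_funTS/measurableT_comp.
    + by move=> x Kx; rewrite /= in_itv/= -ler_norml; exact: KM.
  move/lebesgue_differentiation.
  apply: (@filterS _ _ (ae_filter_ringOfSetsType mu)) => x hx _.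
  exact: avg_lebesgue_pt.
Qed.

(** An average of h is bounded, so its averages are Lipschitz; the inequality
goes from these back to the average of h, and from there to h. *)
Lemma parseval h : psqint h -> parseval_le h.
Proof.
move=> ph; apply: parseval_le_avg => // e e0.
have pe := psqint_avg e0 ph.
have [M hM] := avg_bounded e0 ph.
apply: parseval_le_avg => // d d0; have [sd pd] := psqint_avg d0 pe.
by apply: (parseval_le_lipschitz sd pd (avg_lipschitz d0 _ hM)); case: pe => -[].
Qed.

End parseval.

(** * Rearranged scalar series and convergence of multipliers *)

Section scalar_series.
Context {R : realType}.
Implicit Types d v : nat -> R.

Lemma cvg_sum_seq (J : Type) (s : seq J) (F : J -> nat -> R) (l : J -> R) :
  (forall j, F j N @[N --> \oo] --> l j) ->
  \sum_(j <- s) F j N @[N --> \oo] --> \sum_(j <- s) l j.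
Proof.
move=> Fl; elim: s => [|j s IH].
  by under eq_fun do rewrite big_nil; rewrite big_nil; exact: cvg_cst.
by under eq_fun do rewrite big_cons; rewrite big_cons; exact: cvgD.
Qed.

(** Sums of nonnegative terms are sums over the index set, which do not see the
order. *)
Lemma nonneg_series_perm v (C : R) (p : nat -> nat) : (forall k, 0 <= v k) ->
  (forall N, \sum_(0 <= k < N) v k <= C) -> bijective p ->
  exists S : R, [/\ S <= C, (forall N, \sum_(0 <= k < N) v (p k) <= S),
    \sum_(0 <= k < N) v k @[N --> \oo] --> S &
    \sum_(0 <= k < N) v (p k) @[N --> \oo] --> S].
Proof.
move=> v0 vC bp.
have ev0 (w : nat -> R) : (forall k, 0 <= w k) -> forall k, (0 <= (w k)%:E)%E.
  by move=> w0 k; rewrite lee_fin.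
have ES : (\sum_(0 <= k <oo) (v k)%:E = \sum_(0 <= k <oo) (v (p k))%:E)%E.
  rewrite !nneseries_esumT//; try by move=> k; rewrite lee_fin.
  apply: reindex_esum; split => //.
    by move=> x y _ _; exact: (bij_inj bp).
  by case: bp => q pq qp y _; exists (q y).
have SC : (\sum_(0 <= k <oo) (v k)%:E <= C%:E)%E.
  apply: lime_le; first by apply: is_cvg_nneseries => *; rewrite lee_fin.
  by apply: nearW => N; rewrite sumEFin lee_fin.
have [S SE] : exists S : R, (\sum_(0 <= k <oo) (v k)%:E = S%:E)%E.
  exists (fine (\sum_(0 <= k <oo) (v k)%:E)%E); rewrite fineK// ge0_fin_numE.
    by rewrite (le_lt_trans SC) ?ltry.
  by apply: nneseries_ge0 => *; rewrite lee_fin.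
have key (w : nat -> R) : (forall k, 0 <= w k) ->
    (\sum_(0 <= k <oo) (w k)%:E = S%:E)%E ->
    \sum_(0 <= k < N) w k @[N --> \oo] --> S.
  move=> w0 wS; apply: (fine_cvg (f := fun N => (\sum_(0 <= k < N) w k)%:E)).
  rewrite -wS; under eq_fun do rewrite -sumEFin.
  by apply: is_cvg_nneseries => *; rewrite lee_fin.
exists S; split.
- by rewrite -lee_fin -SE.
- move=> N; rewrite -lee_fin -SE ES -sumEFin.
  by apply: nneseries_lim_ge => *; rewrite lee_fin.
- exact: key.
- by apply: key => //; rewrite -ES.
Qed.

(** Write d = (|d| + d) - |d| and rearrange the two nonnegative series. *)
Lemma abs_series_perm d (C L : R) (p : nat -> nat) :
  (forall N, \sum_(0 <= k < N) `|d k| <= C) -> bijective p ->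
  \sum_(0 <= k < N) d k @[N --> \oo] --> L ->
  (forall N, `|\sum_(0 <= k < N) d (p k)| <= C) /\
  \sum_(0 <= k < N) d (p k) @[N --> \oo] --> L.
Proof.
move=> dC bp dL.
have [S [SC pS c1 c2]] := nonneg_series_perm (fun k => normr_ge0 (d k)) dC bp.
have v0 k : 0 <= `|d k| + d k.
  by have := ler_norm (- d k); rewrite normrN; lra.
have vC N : \sum_(0 <= k < N) (`|d k| + d k) <= C + C.
  rewrite big_split/= lerD// (le_trans _ (dC N))// ler_sum// => k _.
  exact: ler_norm.
have [S' [_ _ c3 c4]] := nonneg_series_perm v0 vC bp.
split.
  move=> N; apply: le_trans (ler_norm_sum _ _ _) _; exact: le_trans (pS N) SC.
have dE (q : nat -> nat) : (fun N => \sum_(0 <= k < N) d (q k)) =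
    (fun N => \sum_(0 <= k < N) (`|d (q k)| + d (q k)) - \sum_(0 <= k < N) `|d (q k)|).
  by apply/funext => N; rewrite -sumrB; apply: eq_bigr => k _;
    rewrite addrAC subrr add0r.
have -> : L = S' - S.
  have c5 : \sum_(0 <= k < N) d k @[N --> \oo] --> S' - S.
    by rewrite (dE id); exact: cvgB.
  by rewrite -(cvg_lim _ dL)// -(cvg_lim _ c5).
by rewrite dE; exact: cvgB.
Qed.

End scalar_series.

Section multipliers.
Context {R : realType}.
Implicit Types h : R -> R.

Lemma energy_tail h (e : R) : psqint h -> 0 < e ->
  exists M, forall N, \sum_(n <- iota 0 N) energy h n <=
    \sum_(n <- iota 0 M) energy h n + e.
Proof.
move=> ph e0.
pose S N := \sum_(n <- iota 0 N) energy h n.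
have ndS : {homo S : n m / (n <= m)%N >-> n <= m}.
  move=> n m nm; rewrite /S -(subnKC nm) iotaD big_cat/= lerDl.
  by apply: sumr_ge0 => i _; exact: energy_ge0.
have cS : cvgn S.
  apply: nondecreasing_is_cvgn => //.
  by exists (ip h h) => _ [N _ <-]; apply: bessel; exact: ph.1.
have cS' : S n @[n --> \oo] --> limn S by exact: cS.
move/cvgr_dist_lt : cS' => /(_ _ e0) [M _ /(_ M (leqnn M))] /=;
  rewrite ltr_distl => /andP[_ lM].
exists M => N; apply: le_trans (nondecreasing_cvgn_le ndS cS N) _; exact: ltW.
Qed.

(** Dominated convergence over the frequencies: beyond a frequency M the
energies of h have a small sum and the multipliers are bounded by K; below M
there are finitely many terms, each tending to 0. *)
Lemma multiplier_cvg0 (m : nat -> nat -> R) (u : nat -> R -> R) h (K : R) :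
  psqint h -> (forall N, psqint (u N)) ->
  (forall N b n, coef (u N) b n = m N n * coef h b n) ->
  (forall N n, `|m N n| <= K) ->
  (forall n, m N n @[N --> \oo] --> 0) ->
  ip (u N) (u N) @[N --> \oo] --> 0.
Proof.
move=> ph pu um mK m0.
have EE N n : energy (u N) n = m N n ^+ 2 * energy h n.
  by rewrite /energy !um !exprMn; ring.
have m2 N n : m N n ^+ 2 <= K ^+ 2.
  rewrite -real_normK ?num_real// ler_sqr ?nnegrE//.
  exact: le_trans (mK N n).
apply/cvgr0Pnorm_lt => e e0.
(* K ^+ 2 * e1 <= e / 2, also when K = 0 *)
pose e1 := e / 2 / (K ^+ 2 + 1).
have K1 : 0 < K ^+ 2 + 1 by rewrite ltr_wpDl ?sqr_ge0.
have e10 : 0 < e1 by rewrite !divr_gt0.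
have [M hM] := energy_tail ph e10.
have c0 : \sum_(n <- iota 0 M) m N n ^+ 2 * energy h n @[N --> \oo] --> 0.
  have z : \sum_(n <- iota 0 M) (0 : R) = 0 by rewrite big1.
  rewrite -[X in _ --> X]z.
  apply: cvg_sum_seq => n; rewrite -(mul0r (energy h n)); apply: cvgM;
    last exact: cvg_cst.
  rewrite -[X in _ --> X](mulr0 (0 : R)); under eq_fun do rewrite expr2.
  by apply: cvgM; exact: m0.
have e2 : 0 < e / 2 by rewrite divr_gt0.
move/cvgr0Pnorm_lt : c0 => /(_ _ e2); apply: filterS => N.
rewrite ger0_norm; last first.
  by apply: sumr_ge0 => n _; rewrite mulr_ge0 ?sqr_ge0// energy_ge0.
move=> sN; rewrite ger0_norm ?ip_ge0//.
suff : ip (u N) (u N) <= \sum_(n <- iota 0 M) m N n ^+ 2 * energy h n + K ^+ 2 * e1.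
  move=> /le_lt_trans; apply; rewrite [ltRHS](splitr e); apply: ltr_leD => //.
  rewrite /e1 mulrA ler_pdivrMr// mulrC ler_wpM2l ?ltW//; lra.
apply: parseval (pu N) _ _ => N'.
(* only sums up to N2 >= M can be split at M; the extra terms are nonnegative *)
pose N2 := maxn N' M.
apply: (@le_trans _ _ (\sum_(n <- iota 0 N2) energy (u N) n)).
  rewrite /N2 -(subnKC (leq_maxl N' M)) iotaD big_cat/= lerDl.
  by apply: sumr_ge0 => i _; exact: energy_ge0.
have NE : iota 0 N2 = iota 0 M ++ iota M (N2 - M).
  by rewrite /N2 -{1}(subnKC (leq_maxr N' M)) iotaD add0n.
rewrite NE big_cat/= lerD//.
  by rewrite (eq_bigr (fun n => m N n ^+ 2 * energy h n))// => n _; exact: EE.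
apply: (@le_trans _ _ (K ^+ 2 * \sum_(n <- iota M (N2 - M)) energy h n)).
  rewrite mulr_sumr; apply: ler_sum => n _.
  by rewrite EE ler_wpM2r// energy_ge0.
rewrite ler_wpM2l ?sqr_ge0//.
by have := hM N2; rewrite NE big_cat/= lerD2l.
Qed.

(** By the mean value theorem phi e n is the cosine of a point between 0 and
n e. *)
Lemma phi_cos_le (e : R) n : 0 < e -> n%:R * e <= pi -> cos (n%:R * e) <= phi e n.
Proof.
move=> e0 ne; rewrite /phi; have [->|n0] := eqVneq n 0%N; first by rewrite mul0r cos0.
have x0 : 0 < n%:R * e by rewrite mulr_gt0 ?ltr0n ?lt0n.
move: (n%:R * e) x0 ne => x x0 xpi.
have cs : {within `[0, x], continuous (@sin R)}.
  by apply: continuous_subspaceT; exact: continuous_sin.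
have [c] := MVT_segment (ltW x0) (fun x _ => is_derive_sin x) cs.
rewrite in_itv/= sin0 !subr0 => /andP[c0 cx] ->.
rewrite mulfK ?gt_eqF//.
have [->//|cn] := eqVneq c x.
by apply: ltW; rewrite ltr_cos ?in_itv/=; [rewrite lt_neqAle cn|lra|lra].
Qed.

Lemma phi_cvg1 (eps : nat -> R) n : (forall k, 0 < eps k) ->
  eps k @[k --> \oo] --> 0 -> phi (eps k) n @[k --> \oo] --> (1 : R).
Proof.
move=> eps0 epsc; have c0 : n%:R * eps k @[k --> \oo] --> 0.
  by rewrite -(mulr0 n%:R); apply: cvgM => //; exact: cvg_cst.
apply: (@squeeze_cvgr _ _ _ _ (fun k => cos (n%:R * eps k)) (cst (1 : R))).
- move/cvgr0_norm_le : (c0) => /(_ _ (pi_gt0 R)); apply: filterS => k xk.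
  rewrite (le_trans (ler_norm _) (phi_le1 _ _))// andbT phi_cos_le//.
  exact: le_trans (ler_norm _) xk.
- rewrite -[X in _ --> X](@cos0 R);
    have cc : {for 0, continuous (@cos R)} by exact: continuous_cos.
  exact: (continuous_cvg _ cc c0).
- exact: cvg_cst.
Qed.

Lemma phihatE (e : R) (l : int) : phihat e l = phi e `|l|%N.
Proof.
case: l => n; rewrite /phihat /phi.
  by rewrite absz_nat eqz_nat; case: eqP => // _; rewrite -pmulrn.
by rewrite /= NegzE mulrNz !mulNr sinN invrN mulrNN -pmulrn.
Qed.

End multipliers.

(** * From functions on the circle to periodic functions *)

Section circle_functions.
Context {R : realType}.
Local Notation mu := (@lebesgue_measure R).
Local Notation I := `[- pi, (pi : R)]%classic.
Local Open Scope complex_scope.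
Import ComplexField.Normc.
Implicit Types f g : circle R -> R[i].

Lemma circleM_expi (x y : R) : circleM (expi x) (expi y) = expi (x + y).
Proof.
apply: val_inj => /=; rewrite cosD sinD; simpc; congr (_ +i* _).
by rewrite addrC.
Qed.

Lemma expi_periodic : periodic2pi (@expi R).
Proof.
by move=> x; apply: val_inj => /=; rewrite cosD2pi sinD2pi.
Qed.

Definition re_expi f (x : R) : R := complex.Re (f (expi x)).
Definition im_expi f (x : R) : R := complex.Im (f (expi x)).

Lemma re_expi_periodic f : periodic2pi (re_expi f).
Proof. by move=> x; rewrite /re_expi expi_periodic. Qed.

Lemma im_expi_periodic f : periodic2pi (im_expi f).
Proof. by move=> x; rewrite /im_expi expi_periodic. Qed.

Lemma re_expi_Davg (e : R) f x : re_expi (Davg e f) x = avg e (re_expi f) x.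
Proof.
rewrite /re_expi /Davg /avg; simpc => /=.
by congr (_ * _); apply: eq_Rintegral => y _; rewrite circleM_expi.
Qed.

Lemma im_expi_Davg (e : R) f x : im_expi (Davg e f) x = avg e (im_expi f) x.
Proof.
rewrite /im_expi /Davg /avg; simpc => /=.
by congr (_ * _); apply: eq_Rintegral => y _; rewrite circleM_expi.
Qed.

(** This is the definition of the quotient sigma-algebra on the circle. *)
Lemma measurable_circleP (F : circle R -> R) :
  measurable_fun setT F <-> measurable_fun setT (F \o expi).
Proof.
split=> mF; first exact: (measurableT_comp mF measurable_expi).
by move=> _ A mA; rewrite setTI; exact: (mF measurableT A mA).
Qed.

Lemma integral_arc (G : circle R -> R) : measurable_fun setT G ->
  (forall z, 0 <= G z) ->
  (\int[arc_measure]_z (G z)%:E =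
   ((pi *+ 2)^-1)%:E * \int[mu]_(x in I) (G (expi x))%:E)%E.
Proof.
move=> mG G0; rewrite /arc_measure ge0_integral_distribution; first last.
- by move=> z; rewrite lee_fin.
- exact/measurable_EFinP.
rewrite integral_uniform//=.
- by rewrite opprK -mulr2n.
- by apply/measurable_EFinP; exact/measurable_circleP.
- by move=> z; rewrite lee_fin.
Qed.

Definition L2sq f : \bar R :=
  (\int[mu]_(x in I) (re_expi f x ^+ 2 + im_expi f x ^+ 2)%:E)%E.

Lemma measurable_cfunP f :
  measurable_cfun f <-> measurable_fun setT (re_expi f) /\ measurable_fun setT
    (im_expi f).
Proof.
by split=> -[m1 m2]; split; [exact: (measurable_circleP _).1 m1|
  exact: (measurable_circleP _).1 m2|exact: (measurable_circleP _).2 m1|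
  exact: (measurable_circleP _).2 m2].
Qed.

Lemma normc_sqr (z : R[i]) : `|normc z| `^ 2 = complex.Re z ^+ 2 + complex.Im z ^+ 2.
Proof.
case: z => a b /=; rewrite (powR_mulrn 2)// ger0_norm ?sqrtr_ge0//.
by rewrite sqr_sqrtr// addr_ge0 ?sqr_ge0.
Qed.

Lemma L2normE f : measurable_cfun f ->
  L2norm f = ((((pi *+ 2)^-1)%:E * L2sq f) `^ 2^-1)%E.
Proof.
move=> [m1 m2]; rewrite /L2norm unlock; congr poweR.
rewrite -[RHS](@integral_arc (fun z => complex.Re (f z) ^+ 2 + complex.Im (f z) ^+ 2)).
- apply: eq_integral => z _ /=.
  by rewrite -normc_sqr.
- by apply: measurable_funD; apply: measurable_funX.
- by move=> z; rewrite addr_ge0 ?sqr_ge0.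
Qed.

Lemma L2sqE f : sqint (re_expi f) -> sqint (im_expi f) ->
  L2sq f = (ip (re_expi f) (re_expi f) + ip (im_expi f) (im_expi f))%:E.
Proof.
move=> sr si; rewrite EFinD -!integral_sqr// /L2sq.
rewrite -ge0_integralD//=.
- by move=> x _; rewrite lee_fin sqr_ge0.
- by apply/measurable_EFinP/measurable_funTS/measurable_funX; case: sr.
- by move=> x _; rewrite lee_fin sqr_ge0.
- by apply/measurable_EFinP/measurable_funTS/measurable_funX; case: si.
Qed.

Lemma L2norm_sqrt f : sqint (re_expi f) -> sqint (im_expi f) -> L2norm f =
  (Num.sqrt ((pi *+ 2)^-1 * (ip (re_expi f) (re_expi f) +
    ip (im_expi f) (im_expi f))))%:E.
Proof.
move=> sr si; rewrite L2normE; last first.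
  by apply/measurable_cfunP; split; [case: sr|case: si].
rewrite L2sqE// -EFinM poweR_EFin powR12_sqrt// mulr_ge0 ?addr_ge0 ?ip_ge0//.
by rewrite invr_ge0 mulrn_wge0// pi_ge0.
Qed.

(** Through this equivalence all questions about L2 of the circle become
questions about pairs of periodic real functions. *)
Lemma in_L2P f : in_L2 f <-> psqint (re_expi f) /\ psqint (im_expi f).
Proof.
split=> [[mf]|[pr ps]]; last first.
  split; last by rewrite L2norm_sqrt ?ltry//; [exact: pr.1|exact: ps.1].
  by apply/measurable_cfunP; split; [exact: pr.1.1|exact: ps.1.1].
rewrite L2normE// => fin.
have [mr mi] := (measurable_cfunP f).1 mf.
have pi2 : 0 < (pi *+ 2)^-1 :> R by rewrite invr_gt0 pmulrn_rgt0// pi_gt0.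
have {}fin : (L2sq f < +oo)%E.
  rewrite ltey; apply/eqP => foo; move: fin; rewrite foo gt0_muley ?lte_fin//.
  by rewrite poweRyr ?invr_eq0.
have key (h : R -> R) : measurable_fun setT h ->
    (forall x, h x ^+ 2 <= re_expi f x ^+ 2 + im_expi f x ^+ 2) -> sqint h.
  move=> mh hf; split=> //; apply/integrableP; split.
    by apply/measurable_EFinP/measurable_funTS/measurable_funX.
  apply: le_lt_trans fin; apply: ge0_le_integral => //.
  - do 2 apply: measurableT_comp => //.
    by apply/measurable_funTS/measurable_funX.
  - by apply/measurable_EFinP/measurable_funTS/measurable_funD;
      apply: measurable_funX.
  - by move=> x _; rewrite /= lee_fin ger0_norm ?sqr_ge0.
split; split; try exact: re_expi_periodic; try exact: im_expi_periodic.
  by apply: key => // x; rewrite lerDl sqr_ge0.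
by apply: key => // x; rewrite lerDr sqr_ge0.
Qed.

Lemma re_expiB f g x : re_expi (f - g) x = re_expi f x - re_expi g x.
Proof.
rewrite /re_expi -[(f - g) _]/(f (expi x) - g (expi x)).
by case: (f _) (g _) => [a b] [c d].
Qed.

Lemma im_expiB f g x : im_expi (f - g) x = im_expi f x - im_expi g x.
Proof.
rewrite /im_expi -[(f - g) _]/(f (expi x) - g (expi x)).
by case: (f _) (g _) => [a b] [c d].
Qed.

Lemma re_expiD f g x : re_expi (f + g) x = re_expi f x + re_expi g x.
Proof.
rewrite /re_expi -[(f + g) _]/(f (expi x) + g (expi x)).
by case: (f _) (g _) => [a b] [c d].
Qed.

Lemma re_expi_series (u : nat -> circle R -> R[i]) N x :
  re_expi (series u N) x = \sum_(0 <= k < N) re_expi (u k) x.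
Proof.
rewrite /series /=; elim: N => [|N IH]; first by rewrite !big_nil.
by rewrite !big_nat_recr//= re_expiD IH.
Qed.

Lemma im_expiD f g x : im_expi (f + g) x = im_expi f x + im_expi g x.
Proof.
rewrite /im_expi -[(f + g) _]/(f (expi x) + g (expi x)).
by case: (f _) (g _) => [a b] [c d].
Qed.

Lemma im_expi_series (u : nat -> circle R -> R[i]) N x :
  im_expi (series u N) x = \sum_(0 <= k < N) im_expi (u k) x.
Proof.
rewrite /series /=; elim: N => [|N IH]; first by rewrite !big_nil.
by rewrite !big_nat_recr//= im_expiD IH.
Qed.

End circle_functions.

(** * Bounded variation of the multipliers is sufficient *)

Section unconditional.
Context {R : realType}.
Context (eps : nat -> R) (eps_gt0 : forall k, 0 < eps k).
Implicit Types (h g : R -> R) (p : nat -> nat).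

Definition delta (k n : nat) : R := phi (eps k.+1) n - phi (eps k) n.

Definition davgs p (s : seq nat) h (x : R) : R :=
  \sum_(k <- s) (avg (eps (p k).+1) h x - avg (eps (p k)) h x).

Lemma psqintB h g : psqint h -> psqint g -> psqint (fun x => h x - g x).
Proof.
by move=> [sh ph] [sg pg]; split; [exact: sqintB|move=> x; rewrite ph pg].
Qed.

Lemma coefB h g b n : sqint h -> sqint g ->
  coef (fun x => h x - g x) b n = coef h b n - coef g b n.
Proof. by move=> sh sg; apply: ipBl => //; exact: sqint_wave. Qed.

Lemma psqint_davgs p s h : psqint h -> psqint (davgs p s h).
Proof.
move=> ph; split.
  by apply: sqint_sum => k; apply: sqintB; apply: (psqint_avg _ ph).1.
by move=> x; apply: eq_bigr => k _; rewrite !avg_periodic//; exact: ph.2.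
Qed.

Lemma coef_davgs p s h b n : psqint h ->
  coef (davgs p s h) b n = (\sum_(k <- s) delta (p k) n) * coef h b n.
Proof.
move=> ph; rewrite /coef ip_suml; last exact: sqint_wave.
  rewrite mulr_suml; apply: eq_bigr => k _; rewrite mulrBl -!coef_avg//.
  by apply: coefB; apply: (psqint_avg _ ph).1.
by move=> k; apply: sqintB; apply: (psqint_avg _ ph).1.
Qed.

Context (eps_cvg0 : eps k @[k --> \oo] --> 0).

(** The limit is h minus its first average: the series telescopes frequency by
frequency, and the rearrangement does not change the scalar sums. *)
Lemma davgs_perm_cvg (C : R) p h :
  (forall n N, \sum_(0 <= k < N) `|delta k n| <= C) -> bijective p -> psqint h ->
  let V N := fun x => davgs p (index_iota 0 N) h x - (h x - avg (eps 0%N) h x) in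
  ip (V N) (V N) @[N --> \oo] --> 0.
Proof.
move=> dC bp ph V.
have pa : psqint (avg (eps 0%N) h) by exact: psqint_avg.
have pg : psqint (fun x => h x - avg (eps 0%N) h x) by exact: psqintB.
pose m N n := \sum_(0 <= k < N) delta (p k) n - (1 - phi (eps 0%N) n).
have dL n : \sum_(0 <= k < N) delta k n @[N --> \oo] --> 1 - phi (eps 0%N) n.
  rewrite (_ : (fun N => _) = fun N => phi (eps N) n - phi (eps 0%N) n).
    by apply: cvgB; [exact: phi_cvg1|exact: cvg_cst].
  by apply/funext => N; rewrite telescope_sumr.
apply: (@multiplier_cvg0 _ m V h (C + 2) ph).
- by move=> N; apply: psqintB => //; exact: psqint_davgs.
- move=> N b n; rewrite coefB; [|exact: (psqint_davgs _ _ ph).1|exact: pg.1].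
  rewrite coef_davgs// coefB; [|exact: ph.1|exact: pa.1].
  by rewrite coef_avg// /m; ring.
- move=> N n; apply: le_trans (ler_normB _ _) _; apply: lerD.
    by have [] := abs_series_perm (dC n) bp (dL n).
  apply: le_trans (ler_normB _ _) _; rewrite normr1.
  by have := @phi_le1 _ (eps 0%N) n (eps_gt0 0%N); lra.
- move=> n; apply/subr_cvg0.
  by have [] := abs_series_perm (dC n) bp (dL n).
Qed.

Lemma bounded_variation_unconditional (C : R) (f : circle R -> R[i]) :
  (forall n N, \sum_(0 <= k < N) `|delta k n| <= C) -> in_L2 f ->
  L2_unconditionally_convergent (fun k => Davg (eps k.+1) f - Davg (eps k) f).
Proof.
move=> dC /in_L2P[pr ps] p bp.
exists (f - Davg (eps 0%N) f).
  apply/in_L2P; split.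
    rewrite (_ : re_expi _ = fun x => re_expi f x - avg (eps 0%N) (re_expi f) x).
      by apply: psqintB => //; exact: psqint_avg.
    by apply/funext => x; rewrite re_expiB re_expi_Davg.
  rewrite (_ : im_expi _ = fun x => im_expi f x - avg (eps 0%N) (im_expi f) x).
    by apply: psqintB => //; exact: psqint_avg.
  by apply/funext => x; rewrite im_expiB im_expi_Davg.
pose V h N := fun x => davgs p (index_iota 0 N) h x - (h x - avg (eps 0%N) h x).
have pV h N : psqint h -> psqint (V h N).
  move=> ph; apply: psqintB; first exact: psqint_davgs.
  by apply: psqintB => //; exact: psqint_avg.
pose w N := series ((fun k => Davg (eps k.+1) f - Davg (eps k) f) \o p) N -
  (f - Davg (eps 0%N) f).
have rw N : re_expi (w N) = V (re_expi f) N.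
  apply/funext => x; rewrite !re_expiB re_expi_series re_expi_Davg; congr (_ - _).
  by apply: eq_bigr => k _; rewrite /= re_expiB !re_expi_Davg.
have iw N : im_expi (w N) = V (im_expi f) N.
  apply/funext => x; rewrite !im_expiB im_expi_series im_expi_Davg; congr (_ - _).
  by apply: eq_bigr => k _; rewrite /= im_expiB !im_expi_Davg.
have wE N : L2norm (w N) = (Num.sqrt ((pi *+ 2)^-1 *
    (ip (V (re_expi f) N) (V (re_expi f) N) +
      ip (V (im_expi f) N) (V (im_expi f) N))))%:E.
  rewrite L2norm_sqrt ?rw ?iw//; first exact: (pV _ _ pr).1.
  exact: (pV _ _ ps).1.
rewrite [X in X @ _ --> _](_ : _ = fun N => (Num.sqrt ((pi *+ 2)^-1 *
    (ip (V (re_expi f) N) (V (re_expi f) N) +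
      ip (V (im_expi f) N) (V (im_expi f) N))))%:E); last first.
  by apply/funext => N; exact: wE.
apply: cvg_EFin; first exact: nearW.
rewrite -[X in _ --> X](@sqrtr0 R).
apply: (@continuous_cvg _ _ _ _ _ _ Num.sqrt); first exact: sqrt_continuous.
rewrite -(mulr0 (pi *+ 2)^-1); apply: cvgM; first exact: cvg_cst.
by rewrite -[X in _ --> X](addr0 0); apply: cvgD; apply: davgs_perm_cvg dC bp _.
Qed.

End unconditional.

(** * Rearrangements inside blocks and sums of cosines *)

Section block_permutation.
Context (N : nat -> nat) (F : nat -> pred nat).
Context (N0 : N 0%N = 0%N) (Ninc : forall j, (N j < N j.+1)%N).

Lemma block_ge j : (j <= N j)%N.
Proof. by elim: j => // j IH; exact: leq_ltn_trans IH (Ninc j). Qed.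

Lemma block_homo : {homo N : i j / (i <= j)%N}.
Proof. by apply: homo_leq => [//|? ? ?|j]; [exact: leq_trans|exact: ltnW]. Qed.

Let in_block j k := (N j <= k < N j.+1)%N.

Let blockP k : exists j, in_block j k.
Proof.
have ex : exists j, (k < N j.+1)%N by exists k; exact: block_ge.
case: (ex_minnP ex) => j jk jmin; exists j; rewrite /in_block jk andbT.
case: j jk jmin => [|j] jk jmin; first by rewrite N0.
by rewrite leqNgt; apply/negP => /jmin; rewrite ltnn.
Qed.

Let block_uniq j j' k : in_block j k -> in_block j' k -> j = j'.
Proof.
move=> /andP[a b] /andP[a' b']; apply/eqP; rewrite eqn_leq; apply/andP; split.
  by rewrite leqNgt; apply/negP => /block_homo jj; move: (leq_trans b' jj);
    rewrite ltnNge a.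
by rewrite leqNgt; apply/negP => /block_homo jj; move: (leq_trans b jj);
  rewrite ltnNge a'.
Qed.

(** A permutation that preserves each block N j, ..., N j.+1 - 1 and lists the
indices selected by F j first. In the statement, m j is the position where the
selected part of block j ends. *)
Lemma block_permutation : exists (p : nat -> nat) (m : nat -> nat),
  [/\ bijective p, forall j, (N j <= m j)%N &
    forall (V : nmodType) (phi : nat -> V) j,
      \sum_(N j <= i < m j) phi (p i) =
      \sum_(N j <= k < N j.+1 | F j k) phi k].
Proof.
have [b bP] := choice blockP.
have bE j k : in_block j k -> b k = j by apply: block_uniq.
pose r j := index_iota (N j) (N j.+1).
pose s1 j := [seq k <- r j | F j k].
pose s j := s1 j ++ [seq k <- r j | predC (F j) k].
have sr j : perm_eq (s j) (r j) by rewrite /s /s1 perm_filterC.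
have us j : uniq (s j) by rewrite (perm_uniq (sr j)) iota_uniq.
have ms j k : (k \in s j) = in_block j k.
  by rewrite (perm_mem (sr j)) mem_index_iota.
have ss j : size (s j) = (N j.+1 - N j)%N by rewrite (perm_size (sr j)) size_iota.
pose p i := nth 0%N (s (b i)) (i - N (b i)).
pose q k := (N (b k) + index k (s (b k)))%N.
have pin i : p i \in s (b i).
  by rewrite mem_nth// ss; have /andP[? ?] := bP i;
    rewrite ltn_sub2r// (leq_ltn_trans _ (Ninc _)).
exists p, (fun j => (N j + size (s1 j))%N); split.
- exists q => [i|k].
    have bpi : b (p i) = b i by apply: bE; rewrite -ms.
    have /andP[bi1 bi2] := bP i.
    rewrite /q bpi /p index_uniq// ?subnKC// ss ltn_sub2r//.
  have kin : k \in s (b k) by rewrite ms.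
  have bq : b (q k) = b k.
    apply: bE; rewrite /in_block leq_addr/= -ltn_subRL -ss.
    by rewrite index_mem.
  by rewrite /p bq /q addKn nth_index.
- by move=> j; exact: leq_addr.
- move=> V phi j; rewrite -[RHS]big_filter -/(s1 j) [RHS](big_nth 0%N).
  rewrite -[X in index_iota X _]add0n big_addn addKn.
  apply: congr_big_nat => // i /andP[_ /andP[_ i1]].
  have bi : b (i + N j)%N = j.
    apply: bE; rewrite /in_block leq_addl/= addnC -ltn_subRL -ss.
    by rewrite (leq_trans i1)// /s size_cat leq_addr.
  by rewrite /p bi addnK /s nth_cat i1.
Qed.

End block_permutation.

Section gliding_hump.
Context {R : realType}.
Local Notation mu := (@lebesgue_measure R).
Local Notation I := `[- pi, (pi : R)]%classic.

(** Either the nonnegative or the negative terms carry half of the variation. *)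
Lemma sign_choice (d : nat -> R) (s : seq nat) : exists F : pred nat,
  (\sum_(k <- s) `|d k|) / 2 <= `|\sum_(k <- s | F k) d k|.
Proof.
have E : \sum_(k <- s) `|d k| =
    `|\sum_(k <- s | 0 <= d k) d k| + `|\sum_(k <- s | ~~ (0 <= d k)) d k|.
  rewrite (bigID (fun k => 0 <= d k))/=; congr (_ + _).
    rewrite ger0_norm; last exact: sumr_ge0.
    by apply: eq_bigr => k /ger0_norm.
  have dn k : ~~ (0 <= d k) -> d k <= 0 by rewrite -ltNge => /ltW.
  rewrite ler0_norm -?sumrN; last exact: sumr_le0.
  by apply: eq_bigr => k /dn /ler0_norm.
have [c|c] := leP ((\sum_(k <- s) `|d k|) / 2) `|\sum_(k <- s | 0 <= d k) d k|.
  by exists (fun k => 0 <= d k).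
by exists (fun k => ~~ (0 <= d k)); lra.
Qed.

(** The partial sums minus, respectively plus, the geometric tail t J form a
nondecreasing, respectively nonincreasing, sequence, so the limit lies between
them. *)
Lemma geometric_series_limit (u : nat -> R) : (forall j, `|u j| <= 4^-1 ^+ j) ->
  cvgn (series u) /\ forall J, `|limn (series u) - series u J| <= 4 / 3 * 4^-1 ^+ J.
Proof.
move=> ub; pose t J : R := 4 / 3 * 4^-1 ^+ J.
have tS J : t J - t J.+1 = 4^-1 ^+ J by rewrite /t exprS; field.
have t0 : t J @[J --> \oo] --> 0.
  rewrite -(mulr0 (4 / 3)); apply: cvgM; first exact: cvg_cst.
  by apply: cvg_expr; rewrite ger0_norm; lra.
pose a J := series u J - t J; pose b J := series u J + t J.
have nda : {homo a : n m / (n <= m)%N >-> n <= m}.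
  apply/nondecreasing_seqP => n.
  rewrite /a seriesSr; have := ub n; have := tS n; rewrite ler_norml; lra.
have ndb : {homo b : n m / (n <= m)%N >-> m <= n}.
  apply/nonincreasing_seqP => n.
  rewrite /b seriesSr; have := ub n; have := tS n; rewrite ler_norml; lra.
have tp J : 0 <= t J by rewrite mulr_ge0// exprn_ge0.
have ca : cvgn a.
  apply: nondecreasing_is_cvgn => //; exists (b 0%N) => _ [J _ <-].
  apply: (@le_trans _ _ (b J)); last exact: ndb.
  by rewrite /a /b; have := tp J; lra.
have ca' : a J @[J --> \oo] --> limn a by exact: ca.
have cu : series u J @[J --> \oo] --> limn a.
  rewrite -(addr0 (limn a)) (_ : series u = fun J => a J + t J); first exact: cvgD.
  by apply/funext => J; rewrite /a subrK.
have cb : b J @[J --> \oo] --> limn a by rewrite -(addr0 (limn a)); exact: cvgD.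
have lu : limn (series u) = limn a by exact/cvg_lim.
have lb : limn b = limn a by exact/cvg_lim.
split; first by apply/cvg_ex; exists (limn a).
move=> J; rewrite lu.
have h1 := nondecreasing_cvgn_le nda ca J.
have cb' : cvgn b by apply/cvg_ex; exists (limn a).
have h2 := nonincreasing_cvgn_ge ndb cb' J.
by rewrite lb in h2; rewrite ler_norml; move: h1 h2; rewrite /a /b /t; lra.
Qed.

Lemma expi_exp (x : R) n :
  sval (expi x) ^+ n = Complex (cos (n%:R * x)) (sin (n%:R * x)).
Proof.
elim: n => [|n IH]; first by rewrite expr0 mul0r cos0 sin0.
rewrite exprS IH -(natr1 n) mulrDl mul1r addrC cosD sinD /=; simpc.
by congr Complex; rewrite addrC.
Qed.

Context (n_ : nat -> nat).

(** The function z |-> sum_j 4 ^ - j Re (z ^ n_j) on the circle. The frequencies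
may repeat: all coefficients are nonnegative, so repetitions only increase
them. *)
Definition cosine_series (z : circle R) : R[i] :=
  Complex (limn (series (fun j => 4^-1 ^+ j * complex.Re (sval z ^+ n_ j)))) 0.

Let part (J : nat) (x : R) : R :=
  \sum_(j <- index_iota 0 J) 4^-1 ^+ j * wave false (n_ j) x.

Lemma cosine_series_approx x J :
  part J x @[J --> \oo] --> re_expi cosine_series x /\
  `|re_expi cosine_series x - part J x| <= 4 / 3 * 4^-1 ^+ J.
Proof.
have E : (fun J => part J x) =
    series (fun j => 4^-1 ^+ j * complex.Re (sval (expi x) ^+ n_ j)).
  apply/funext => K; apply: eq_bigr => j _.
  by rewrite expi_exp wave_cos.
have [|c b] := @geometric_series_limit
    (fun j => 4^-1 ^+ j * complex.Re (sval (expi x) ^+ n_ j)).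
  move=> j; rewrite expi_exp /= normrM ger0_norm ?exprn_ge0//.
  by rewrite -[leRHS]mulr1 ler_wpM2l ?exprn_ge0// cos_max.
split; first by rewrite E; exact: c.
by rewrite -[part J x]/((fun K => part K x) J) E; exact: b.
Qed.

Let sqint_part J : sqint (part J).
Proof. by apply: sqint_sum => j; apply: sqintZ; exact: sqint_wave. Qed.

Lemma psqint_cosine_series : psqint (re_expi cosine_series).
Proof.
split; last exact: re_expi_periodic.
apply: (@sqint_bounded _ (4 / 3)).
  apply: (measurable_fun_cvg (fun J => (sqint_part J).1)).
  by move=> x _; exact: (cosine_series_approx x 0%N).1.
move=> x _; have := (cosine_series_approx x 0%N).2.
by rewrite /part big_nil subr0 expr0 mulr1.
Qed.

Lemma in_L2_cosine_series : in_L2 cosine_series.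
Proof.
apply/in_L2P; split; first exact: psqint_cosine_series.
rewrite (_ : im_expi cosine_series = cst 0); first by split => //; exact: sqint_cst.
exact/funext.
Qed.

(** The terms of index at most j contribute at least 4 ^ - j pi, since those of
index less than j contribute nonnegatively. The remainder is at most
4 ^ - j / 3, so its coefficient is at most 4 ^ - j (2 pi / 3). *)
Lemma coef_cosine_series_ge j :
  4^-1 ^+ j * (pi / 3) <= coef (re_expi cosine_series) false (n_ j).
Proof.
have pi0 := pi_gt0 R; have q0 : 0 <= 4^-1 ^+ j :> R by rewrite exprn_ge0.
have sw := @sqint_wave R false (n_ j).
have sh := psqint_cosine_series.1.
have iww n : 0 <= ip (wave false n) (@wave R false (n_ j)).
  rewrite -(@pmulr_rge0 _ (wgt n)) ?wgt_gt0// wave_orthonormal.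
  exact: ler0n.
have iw : pi <= ip (wave false (n_ j)) (@wave R false (n_ j)).
  have := @wave_orthonormal R false (n_ j) false (n_ j).
  rewrite !eqxx orbT /= => /(canRL (mulKf _)) ->; last by rewrite gt_eqF// wgt_gt0.
  rewrite mulr1 -[leLHS]invrK lef_pV2 ?posrE ?invr_gt0 ?wgt_gt0//.
  rewrite /wgt; case: ifP => // _; rewrite lef_pV2 ?posrE//; lra.
have h1 : 4^-1 ^+ j * pi <= coef (part j.+1) false (n_ j).
  rewrite /coef ip_suml//; last by move=> i; apply: sqintZ; exact: sqint_wave.
  rewrite big_nat_recr//= ipZl//.
  rewrite -[leLHS]add0r lerD ?ler_wpM2l//.
  apply: sumr_ge0 => i _; rewrite ipZl//; last exact: sqint_wave.
  by rewrite mulr_ge0 ?exprn_ge0.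
pose rem x := re_expi cosine_series x - part j.+1 x.
have srem : sqint rem by exact: sqintB.
have h2 : `|coef rem false (n_ j)| <= 4 / 3 * 4^-1 ^+ j.+1 * (pi - - pi).
  apply: Rintegral_itv_bounded; last lra.
    by apply: measurable_funM; [case: srem|exact: measurable_wave].
  move=> x; rewrite normrM -[leRHS]mulr1 ler_pM//.
    exact: (cosine_series_approx x j.+1).2.
  exact: cos_max.
have : coef rem false (n_ j) =
    coef (re_expi cosine_series) false (n_ j) - coef (part j.+1) false (n_ j).
  exact: coefB.
move: h2; rewrite ler_norml exprS; move: q0 h1; move: (_ ^+ j) => q; nra.
Qed.

End gliding_hump.

(** * Bounded variation of the multipliers is necessary *)

Section necessity.
Context {R : realType}.
Context (eps : nat -> R) (eps_gt0 : forall k, 0 < eps k).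

Lemma delta_le2 k n : `|delta eps k n| <= 2.
Proof.
apply: le_trans (ler_normB _ _) _.
by have := phi_le1 n (eps_gt0 k); have := phi_le1 n (eps_gt0 k.+1); lra.
Qed.

(** The first N0 terms contribute at most 2 N0, whatever the frequency. *)
Lemma unbounded_tail : ~ (exists C : R, forall n N,
    \sum_(0 <= k < N) `|delta eps k n| <= C) ->
  forall N0 (B : R), exists n N,
    (N0 < N)%N /\ B <= \sum_(N0 <= k < N) `|delta eps k n|.
Proof.
move=> nC N0 B; apply: contrapT => nE; apply: nC.
exists (B + 2 *+ N0) => n N.
pose M := maxn N N0.+1.
apply: (@le_trans _ _ (\sum_(0 <= k < M) `|delta eps k n|)).
  rewrite [leRHS](@big_cat_nat _ _ _ N)//= ?leq_maxl// lerDl.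
  exact: sumr_ge0.
have N0M : (N0 < M)%N by exact: leq_maxr.
rewrite (@big_cat_nat _ _ _ N0)//= ?(ltnW N0M)// addrC; apply: lerD.
  by rewrite leNgt; apply/negP => /ltW c; apply: nE; exists n, M.
apply: le_trans (ler_sum _ (fun k _ => delta_le2 k n)) _.
by rewrite sumr_const_nat subn0.
Qed.

Lemma unconditional_bounded_variation :
  (forall f : circle R -> R[i], in_L2 f ->
     L2_unconditionally_convergent
       (fun k => Davg (eps k.+1) f - Davg (eps k) f)) ->
  exists C : R, forall n N, \sum_(0 <= k < N) `|delta eps k n| <= C.
Proof.
move=> uncond; apply: contrapT => /unbounded_tail tail.
have pi0 := pi_gt0 R; have pi2 := pi_ge2 R.
have p20 : 0 < (pi : R) *+ 2 by rewrite pmulrn_rgt0.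
have /choice[st stP] : forall jN : nat * nat, exists nM : nat * nat,
    (jN.2 < nM.2)%N /\
    2 * 4 ^+ jN.1 <= \sum_(jN.2 <= k < nM.2) `|delta eps k nM.1|.
  by move=> [j N0]; have [n [N ?]] := tail N0 (2 * 4 ^+ j); exists (n, N).
(* block j is [N j, N j.+1), with frequency n_ j; st chooses both from j and N j *)
pose N := fix N j := if j is j'.+1 then (st (j', N j')).2 else 0%N.
pose n_ j := (st (j, N j)).1.
have Ninc j : (N j < N j.+1)%N by have [] := stP (j, N j).
have big j : 2 * 4 ^+ j <= \sum_(N j <= k < N j.+1) `|delta eps k (n_ j)|.
  by have [] := stP (j, N j).
have /choice[F FP] : forall j, exists F : pred nat,
    4 ^+ j <= `|\sum_(N j <= k < N j.+1 | F k) delta eps k (n_ j)|.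
  move=> j; have [F FP] := sign_choice (delta eps ^~ (n_ j))
    (index_iota (N j) (N j.+1)).
  by exists F; apply: le_trans FP; have := big j; lra.
have [p [m [bp Nm pE]]] := @block_permutation N F erefl Ninc.
pose f := @cosine_series R n_; pose h := re_expi f.
have fL2 : in_L2 f by exact: in_L2_cosine_series.
have ph : psqint h by exact: psqint_cosine_series.
have [g /in_L2P[pr ps] gc] := uncond _ fL2 p bp.
pose w M := series ((fun k => Davg (eps k.+1) f - Davg (eps k) f) \o p) M - g.
have rwE M : re_expi (w M) = fun x => davgs eps p (index_iota 0 M) h x - re_expi g x.
  apply/funext => x; rewrite re_expiB re_expi_series; congr (_ - _).
  by apply: eq_bigr => k _; rewrite /= re_expiB !re_expi_Davg.
have iwE M : im_expi (w M) = fun x => davgs eps p (index_iota 0 M) (im_expi f) x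
  - im_expi g x.
  apply/funext => x; rewrite im_expiB im_expi_series; congr (_ - _).
  by apply: eq_bigr => k _; rewrite /= im_expiB !im_expi_Davg.
have pf : psqint (im_expi f) by have /in_L2P[] := fL2.
have srw M : sqint (re_expi (w M)).
  by rewrite rwE; apply: sqintB; [exact: (psqint_davgs eps_gt0 _ _ ph).1|exact: pr.1].
have siw M : sqint (im_expi (w M)).
  by rewrite iwE; apply: sqintB; [exact: (psqint_davgs eps_gt0 _ _ pf).1|exact: ps.1].
pose X M := (pi *+ 2)^-1 * (ip (re_expi (w M)) (re_expi (w M)) +
  ip (im_expi (w M)) (im_expi (w M))).
have Xc : Num.sqrt (X M) @[M --> \oo] --> 0.
  apply: (fine_cvg (f := fun M => (Num.sqrt (X M))%:E)).
  move: gc; rewrite [X in X @ _ --> _ -> _](_ : _ = fun M => (Num.sqrt (X M))%:E)//.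
  by apply/funext => M; exact: (L2norm_sqrt (srw M) (siw M)).
have c2 : 0 < (pi *+ 2) * 4 :> R by apply: mulr_gt0.
(* with this threshold on the L2 distances, all coefficients are at most 1 / 4 *)
have e0 : 0 < (pi *+ 2 * 4)^-1 :> R by rewrite invr_gt0.
move/cvgr0Pnorm_lt : Xc => /(_ _ e0)[K _ KX].
have small M b n : (K <= M)%N -> `|coef (re_expi (w M)) b n| <= 4^-1.
  move=> /KX /=; rewrite ger0_norm ?sqrtr_ge0// => XM.
  have X0 : 0 <= X M.
    by rewrite mulr_ge0 ?addr_ge0 ?ip_ge0// invr_ge0 (ltW p20).
  have ipX : pi *+ 2 * ip (re_expi (w M)) (re_expi (w M)) <=
    (pi *+ 2 * Num.sqrt (X M)) ^+ 2.
    rewrite exprMn sqr_sqrtr// /X mulrA expr2 mulfK; last first.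
      by rewrite gt_eqF.
    by rewrite ler_wpM2l ?(ltW p20)// lerDl ip_ge0.
  have s0 : 0 <= pi *+ 2 * Num.sqrt (X M) by rewrite mulr_ge0 ?sqrtr_ge0// ltW.
  apply: (@le_trans _ _ (pi *+ 2 * Num.sqrt (X M))).
    rewrite -ler_sqr ?nnegrE// real_normK ?num_real//.
    exact: le_trans (coef_sq_le b n (srw M)) ipX.
  apply: (@le_trans _ _ (pi *+ 2 * (pi *+ 2 * 4)^-1)).
    by rewrite ler_wpM2l ?(ltW p20)// ltW.
  by rewrite invfM mulrA mulfV ?mul1r// gt_eqF.
have KN : (K <= N K)%N by exact: block_ge.
have s1 := small (m K) false (n_ K) (leq_trans KN (Nm K)).
have s2 := small (N K) false (n_ K) KN.
have : `|coef (re_expi (w (m K))) false (n_ K) - coef (re_expi (w (N K))) false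
  (n_ K)| <= 2^-1.
  by apply: le_trans (ler_normB _ _) _; lra.
have sd M : sqint (davgs eps p (index_iota 0 M) h) := (psqint_davgs eps_gt0 _ _ ph).1.
rewrite !rwE !coefB//; try exact: pr.1.
rewrite !coef_davgs// opprB addrA subrK -mulrBl.
(* the difference of the two partial sums is the selected part of block K *)
rewrite (@big_cat_nat _ _ _ (N K) 0 (m K))//=
  addrAC subrr add0r (pE _ (delta eps ^~ (n_ K)) K) normrM.
apply/negP; rewrite -ltNge.
(* pi / 3 > 1 / 2 contradicts the bound by 1 / 4 + 1 / 4 *)
apply: (@lt_le_trans _ _ (4 ^+ K * (4^-1 ^+ K * (pi / 3)))).
  by rewrite mulrA -exprMn mulfV ?expr1n ?mul1r; lra.
apply: ler_pM; rewrite ?exprn_ge0//.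
- by rewrite mulr_ge0 ?exprn_ge0//; lra.
- exact: le_trans (coef_cosine_series_ge n_ K) (ler_norm _).
Qed.

End necessity.

Theorem theorem5p1 (R : realType) (eps : nat -> R)
    (eps_gt0 : forall k, 0 < eps k) (eps_cvg0 : eps n @[n --> \oo] --> 0) :
  (forall f : circle R -> R[i], in_L2 f ->
     L2_unconditionally_convergent
       (fun k => Davg (eps k.+1) f - Davg (eps k) f))
  <->
  (exists C : R,
     (ereal_sup [set (\sum_(0 <= k <oo)
                        `|phihat (eps k.+1) l - phihat (eps k) l|%:E)%E
                | l in [set: int]] <= C%:E)%E).
Proof.
split=> [uncond|[C supC] f fL2].
  have [C hC] := unconditional_bounded_variation eps_gt0 uncond.
  exists C; apply: ge_ereal_sup => _ [l _ <-].
  apply: lime_le; first by apply: is_cvg_nneseries => *; rewrite lee_fin.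
  apply: nearW => N; rewrite sumEFin lee_fin.
  apply: le_trans (hC `|l|%N N); rewrite le_eqVlt; apply/orP; left; apply/eqP.
  by apply: eq_bigr => k _; rewrite !phihatE.
apply: (@bounded_variation_unconditional _ _ eps_gt0 eps_cvg0 C f _ fL2) => n N.
rewrite -lee_fin; apply: le_trans supC; apply: (@le_trans _ _
  (\sum_(0 <= k <oo) `|phihat (eps k.+1) n%:Z - phihat (eps k) n%:Z|%:E)%E); last first.
  by apply: ereal_sup_ubound; exists n%:Z.
rewrite -sumEFin (eq_bigr (fun k => `|phihat (eps k.+1) n%:Z - phihat (eps k)
  n%:Z|%:E)%E).
  by apply: nneseries_lim_ge => *; rewrite lee_fin.
by move=> k _; rewrite !phihatE.
Qed.
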